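(* Let $G$ be a locally compact second countable Hausdorff topological group and let $\Gamma=G\rightrightarrows\{*\}$ be $G$ viewed as a groupoid over a one-point base $M=\{*\}$ endowed with the Dirac measure $\mu=\delta_*$. Then: 1. $\mathcal R=(U,\mathsf E_{\mathcal R}=(\mathsf E^x_{\mathcal R})_{x\in\{*\}},\mathscr H_{\mathcal R}=\{*\}\times\mathcal H_{\mathcal R}\to\{*\})$ is a $\delta_*$-admissible groupoid quantum reference frame for $\Gamma$ if and only if $(U_{\mathcal R}\equiv U,\mathsf E_{\mathcal R}\equiv\mathsf E^*_{\mathcal R},\mathcal H_{\mathcal R})$ is a group quantum reference frame for $G$. 2. $\mathcal S=(V,\mathscr H_{\mathcal S}=\{*\}\times\mathcal H_{\mathcal S}\to\{*\})$ is a $\Gamma$-system if and only if $(U_{\mathcal S}\equiv V,\mathcal H_{\mathcal S})$ is a $G$-system. 3. $\mathscr D(\mathcal H_{\mathcal R})=\mathscr D(\mathscr H_{\mathcal R})=\mathscr S(\mathscr H_{\mathcal R})$ and $\mathscr D(\mathcal H_{\mathcal S})=\mathscr D(\mathscr H_{\mathcal S})=\mathscr S(\mathscr H_{\mathcal S})$. 4. $\mathcal A(\mathscr H_{\mathcal S})=\mathcal B(\mathcal H_{\mathcal S})$, $\mathcal A(\mathscr H_{\mathcal S}\boxtimes\mathscr H_{\mathcal R})=\mathcal B(\mathcal H_{\mathcal S}\otimes\mathcal H_{\mathcal R})$ and $\mathcal A(\mathscr H_{\mathcal S}\boxtimes\mathscr H_{\mathcal R})^\Gamma=\mathcal B(\mathcal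 H_{\mathcal S}\otimes\mathcal H_{\mathcal R})^G$. 5. For all $A\in\mathcal B(\mathcal H_{\mathcal S})$ and all $\omega\in\mathscr D(\mathcal H_{\mathcal R})$, $\mathrm{Rel}^{\mathcal R}(A)=Y^{\mathcal R}(A)$ and $\mathrm{Rel}^{\mathcal R}_\omega(A)=Y^{\mathcal R}_\omega(A)$, where $\mathrm{Rel}$ denotes the groupoid relativization maps and $Y$ the group relativization maps.
   Context: Hilbert spaces are complex separable. $\mathscr D(\mathcal H)$: density operators on a Hilbert space $\mathcal H$. **Group side.** A group quantum reference frame for $G$ is $(U_{\mathcal R},\mathsf E_{\mathcal R},\mathcal H_{\mathcal R})$ with $U_{\mathcal R}:G\to\mathcal U(\mathcal H_{\mathcal R})$ an ultraweakly continuous unitary representation and $\mathsf E_{\mathcal R}:\mathrm{Bor}(G)\to\mathcal E(\mathcal H_{\mathcal R})$ a normalized POVM with $U_{\mathcal R}(g)\mathsf E_{\mathcal R}(\Delta)U_{\mathcal R}(g)^\dagger=\mathsf E_{\mathcal R}(g\Delta)$. A $G$-system is $(U_{\mathcal S},\mathcal H_{\mathcal S})$ with $U_{\mathcal S}$ an ultraweakly continuous unitary representation of $G$. $\mathcal B(\mathcal H_{\mathcal S}\otimes\mathcal H_{\mathcal R})^G$: operators commuting with all $U_{\mathcal S}(g)\otimes U_{\mathcal R}(g)$. $Y^{\mathcal R}(A):=\int_GU_{\mathcal S}(g)AU_{\mathcal S}(g)^\dagger\otimes d\mathsf E_{\mathcal R}(g)$, $Y^{\mathcal R}_\omega(A):=\int_GU_{\mathcal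 S}(g)AU_{\mathcal S}(g)^\dagger\,d\mu^{\mathsf E_{\mathcal R}}_\omega(g)$ with $\mu^{\mathsf E_{\mathcal R}}_\omega(X)=\mathrm{Tr}[\omega\mathsf E_{\mathcal R}(X)]$. Here and below, $\int f\otimes d\mathsf E$ is the unique bounded operator with $\mathrm{Tr}[(\rho\otimes\tau)\int f\otimes d\mathsf E]=\int\mathrm{Tr}[\rho f]\,d\mathrm{Tr}[\tau\mathsf E(\cdot)]$ for all density operators $\rho,\tau$. **Groupoid side** (continuous groupoid $\Gamma\rightrightarrows M$, source/target $s,t$, $\Gamma^x=t^{-1}(x)$, $L_\alpha\beta=\alpha\circ\beta$, base measure $\mu$). For a continuous field $\mathscr H=\bigsqcup_x\mathcal H^x$: $\mathcal A(\mathscr H)=\int_M^\oplus\mathcal B(\mathcal H^x)d\mu(x)$ (essentially bounded measurable operator fields); $\mathscr S(\mathscr H)$: elements $(\omega_x)$ of $\mathcal A(\mathscr H)$ with $\omega_x$ a density operator a.e.; $\mathscr D(\mathscr H)$: measurable fields of positive trace-class operators $\rho_x$ with $\int_M\mathrm{Tr}[\rho_x]d\mu=1$. A unitary representation $U$ of $\Gamma$ on $\mathscr H$: measurable assignment of unitaries $U_\alpha:\mathcal H^{s(\alpha)}\to\mathcal H^{t(\alpha)}$, $U_{\alpha\circ\beta}=U_\alpha U_\beta$, $U_{1_x}=\mathbb 1$; fibre-wise ultraweakly continuous if $\alpha\mapsto\mathrm{Tr}[U_\alpha\chi_\alpha]$ is continuous for every field $\chi_\alpha\in\mathcal T(\mathcal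 H^{t(\alpha)},\mathcal H^{s(\alpha)})$ that is locally a trace-norm uniform limit of finite-rank fields $\sum_j|\xi^j_{s(\alpha)}\rangle\langle\eta^j_{t(\alpha)}|$ with $\xi^j,\eta^j$ continuous sections. (For the one-point base this means that $g\mapsto\mathrm{Tr}[U_g\chi]$ is continuous for each trace-class $\chi$.) A $\Gamma$-system $(V,\mathscr H_{\mathcal S})$: continuous field with fibre-wise ultraweakly continuous unitary representation $V$. A groupoid quantum reference frame $(U,\mathsf E_{\mathcal R},\mathscr H_{\mathcal R})$: a continuous field with fibre-wise ultraweakly continuous unitary representation $U$ and a measurable family of normalized POVMs $\mathsf E^x_{\mathcal R}:\mathrm{Bor}(\Gamma^x)\to\mathcal E(\mathcal H^x_{\mathcal R})$ with $U_\alpha\mathsf E^{s(\alpha)}_{\mathcal R}(\Delta)U_\alpha^\dagger=\mathsf E^{t(\alpha)}_{\mathcal R}(L_\alpha\Delta)$; $\mu$-admissible if for $\mu$-a.e. $x$, $\mu(N)=0\Rightarrow\mathsf E^x_{\mathcal R}(s^{-1}(N)\cap\Gamma^x)=0$. $\mathscr H_{\mathcal S}\boxtimes\mathscr H_{\mathcal R}=\bigsqcup_x\mathcal H^x_{\mathcal S}\otimes\mathcal H^x_{\mathcal R}$; $\mathcal A(\mathscr H_{\mathcal S}\boxtimes\mathscr H_{\mathcal R})^\Gamma$: fields $B$ with $(V_\alpha\otimes U_\alpha)B_{s(\alpha)}(V_\alpha\otimes U_\alpha)^\dagger=B_{t(\alpha)}$ for all $\alpha$. $\mathrm{Rel}^{\mathcal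 R}(A):=\int_M^\oplus\big(\int_{\Gamma^x}V_\beta A_{s(\beta)}V_\beta^\dagger\otimes d\mathsf E^x_{\mathcal R}(\beta)\big)d\mu(x)$ and $\mathrm{Rel}^{\mathcal R}_\omega(A):=\int_M^\oplus\big(\int_{\Gamma^x}V_\beta A_{s(\beta)}V_\beta^\dagger\,d\mathrm{Tr}[\omega_x\mathsf E^x_{\mathcal R}(\beta)]\big)d\mu(x)$. *)

(* Defs.v *)
From HB Require Import structures.
From mathcomp Require Import all_boot all_order all_algebra.
From mathcomp Require Import all_classical all_reals all_analysis.
From mathcomp Require Import complex.

Set Implicit Arguments.
Unset Strict Implicit.
Unset Printing Implicit Defensive.

Import Order.TTheory GRing.Theory Num.Theory.
Import numFieldNormedType.Exports.

Local Open Scope classical_set_scope.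
Local Open Scope complex_scope.
Local Open Scope ring_scope.

(* The inner product is conjugate-linear in its first argument. The norm of a
   normed module over R[i] takes values in R[i]; [hnorm] is its real version. *)
HB.mixin Record CompleteNormedModule_isHilbert (R : realType) H
    & CompleteNormedModule R[i] H := {
  dot : H -> H -> R[i];
  dot_linear : forall (u v w : H) (a : R[i]),
    dot u (a *: v + w) = a * dot u v + dot u w;
  dot_conj : forall u v : H, dot v u = (dot u v)^*;
  dot_norm : forall u : H, dot u u = `|u| ^+ 2;
  hilbert_separable : exists2 D : set H, countable D & dense D
}.

#[short(type="hilbertType")]
HB.structure Definition Hilbert (R : realType) :=
  {H of CompleteNormedModule R[i] H & CompleteNormedModule_isHilbert R H}.

Definition hnorm (R : realType) (H : hilbertType R) (u : H) : R :=
  complex.Re (`|u| : R[i]).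

(* [R[i]^o] gives access to the topology of the complex field. *)
Definition ccontinuous (R : realType) (X : topologicalType) (f : X -> R[i]) :=
  continuous (f : X -> R[i]^o).

Definition csum (R : realType) (f : nat -> R[i]) (l : R[i]) :=
  series (f : nat -> R[i]^o) @ \oo --> (l : R[i]^o).

Section operators.
Context {R : realType}.

Definition bounded_op (H K : hilbertType R) (T : H -> K) :=
  linear T /\ exists C : R, forall v, hnorm (T v) <= C * hnorm v.

Definition adj (H K : hilbertType R) (T : H -> K) : K -> H :=
  xget (fun=> 0) [set S : K -> H | bounded_op S /\
    forall u v, dot (T u) v = dot u (S v)].

Definition unitary (H K : hilbertType R) (T : H -> K) :=
  [/\ linear T, forall u v, dot (T u) (T v) = dot u v
    & forall w, exists v, T v = w].

(* The order of R[i] is such that 0 <= z forces z to be real. *)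
Definition positive_op (H : hilbertType R) (T : H -> H) :=
  bounded_op T /\ forall v, 0 <= dot v (T v).

Definition effect (H : hilbertType R) (T : H -> H) :=
  bounded_op T /\ forall v, 0 <= dot v (T v) <= dot v v.

Definition ketbra (H K : hilbertType R) (u : K) (v : H) : H -> K :=
  fun w => dot v w *: u.

(* Trace-class operators between Hilbert spaces, as nuclear operators: the trace
   norm is the infimum of sum_n |xi_n| |eta_n| over all the expansions
   T = sum_n |xi_n><eta_n|; it is +oo when T has no summable expansion. *)
Definition trace_norm (H K : hilbertType R) (T : H -> K) : \bar R :=
  ereal_inf [set z | exists (xi : nat -> K) (eta : nat -> H),
    (forall v, series (fun n => ketbra (xi n) (eta n) v) @ \oo --> T v) /\
    z = (\sum_(0 <= n <oo) (hnorm (xi n) * hnorm (eta n))%:E)%E].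

Definition trace_class (H K : hilbertType R) (T : H -> K) :=
  bounded_op T /\ (trace_norm T < +oo)%E.

(* Orthonormal basis of a separable space, padded with zero vectors so that
   finite-dimensional and infinite-dimensional spaces are treated alike. *)
Definition hilbert_basis (H : hilbertType R) (e : nat -> H) :=
  [/\ forall m n, m != n -> dot (e m) (e n) = 0,
      forall n, e n = 0 \/ hnorm (e n) = 1
    & forall v, series (fun n => dot (e n) v *: e n) @ \oo --> v].

Definition is_trace (H : hilbertType R) (T : H -> H) (z : R[i]) :=
  forall e, hilbert_basis e -> csum (fun n => dot (e n) (T (e n))) z.

Definition tr (H : hilbertType R) (T : H -> H) : R[i] :=
  xget 0 [set z | is_trace T z].

Definition density (H : hilbertType R) : set (H -> H) :=
  [set T | [/\ positive_op T, trace_class T & tr T = 1]].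

End operators.

(* A realization of the Hilbert space tensor product; it is unique up to a
   unique unitary compatible with the simple tensors. *)
Record tensor_product (R : realType) (H K : hilbertType R) := TensorProduct {
  tcar :> hilbertType R;
  ten : H -> K -> tcar;
  ten_linearl : forall (a : R[i]) u u' v,
    ten (a *: u + u') v = a *: ten u v + ten u' v;
  ten_linearr : forall (a : R[i]) u v v',
    ten u (a *: v + v') = a *: ten u v + ten u v';
  ten_dot : forall u v u' v', dot (ten u v) (ten u' v') = dot u u' * dot v v';
  ten_dense : dense [set w | exists s : seq (H * K),
    w = \sum_(p <- s) ten p.1 p.2]
}.

Definition tensor_op (R : realType) (H K H' K' : hilbertType R)
    (T : tensor_product H K) (T' : tensor_product H' K')
    (A : H -> H') (B : K -> K') : T -> T' :=
  xget (fun=> 0) [set C : T -> T' | bounded_op C /\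
    forall u v, C (ten T u v) = ten T' (A u) (B v)].
Arguments tensor_op {R H K H' K'} T T' A B _.

Definition borel (X : ptopologicalType) := g_sigma_algebraType (@open X).

Definition Bor (X : ptopologicalType) : set (set X) := <<s @open X >>.
Arguments Bor X : clear implicits.

(* Borel sets of the subspace D of X, seen as subsets of X. *)
Definition Bor_on (X : ptopologicalType) (D : set X) : set (set X) :=
  <<s D, [set O `&` D | O in @open X] >>.

Definition cmeasurable (R : realType) (X : ptopologicalType) (f : X -> R[i]) :=
  measurable_fun [set: borel X] (fun x : borel X => complex.Re (f x)) /\
  measurable_fun [set: borel X] (fun x : borel X => complex.Im (f x)).

Section povm.
Context {R : realType} {X : ptopologicalType}.

(* Normalized POVM on D with sigma-algebra B (additivity is in the weak
   operator topology). *)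
Definition is_povm (H : hilbertType R) (D : set X) (B : set (set X))
    (E : set X -> H -> H) :=
  [/\ forall S, B S -> effect (E S), E D = id
    & forall F : nat -> set X, (forall n, B (F n)) -> trivIset setT F ->
      forall u v, csum (fun n => dot u (E (F n) v))
                       (dot u (E (\bigcup_n F n) v))].

(* The measure S |-> Tr[w E(S)], for a POVM E on the subspace D of X, seen as
   a measure on X concentrated on D. *)
Definition born (H : hilbertType R) (D : set X) (E : set X -> H -> H)
    (w : H -> H) : set X -> \bar R :=
  fun S => (complex.Re (tr (w \o E (S `&` D))))%:E.

(* [integral] accepts any set function m; it is meant for measures. *)
Definition cintegral (m : set X -> \bar R) (D : set X) (f : X -> R[i]) : R[i] :=
  fine (integral (m : set (borel X) -> \bar R) D (fun x => (complex.Re (f x))%:E)) +i*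
  fine (integral (m : set (borel X) -> \bar R) D (fun x => (complex.Im (f x))%:E)).

(* The weak integral of an operator-valued f, i.e. the bounded operator B with
   Tr[rho B] = \int_D Tr[rho f] dm for all the density operators rho. *)
Definition op_integral (H : hilbertType R) (m : set X -> \bar R) (D : set X)
    (f : X -> H -> H) : H -> H :=
  xget (fun=> 0) [set B : H -> H | bounded_op B /\
    forall rho, density rho ->
      tr (rho \o B) = cintegral m D (fun x => tr (rho \o f x))].

(* The integral of f (x) dE over D, i.e. the bounded operator B with
   Tr[(rho (x) tau) B] = \int_D Tr[rho f] dTr[tau E] for all density operators
   rho and tau. *)
Definition povm_integral (H K : hilbertType R) (T : tensor_product H K)
    (D : set X) (f : X -> H -> H) (E : set X -> K -> K) : T -> T :=
  xget (fun=> 0) [set B : T -> T | bounded_op B /\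
    forall rho tau, density rho -> density tau ->
      tr (tensor_op T T rho tau \o B) =
      cintegral (born D E tau) D (fun x => tr (rho \o f x))].

End povm.
Arguments povm_integral {R X H K} T D f E _.

(* [PointedTopological] instead of [Topological] because the measurable types
   of the library are pointed; the point plays no role. *)
HB.mixin Record Group_isTopologicalGroup G & Group G & PointedTopological G := {
  mulg_continuous : continuous (fun p : G * G => (p.1 * p.2)%g);
  invg_continuous : continuous (fun g : G => (g^-1)%g)
}.

#[short(type="topGroupType")]
HB.structure Definition TopologicalGroup :=
  {G of Group G & PointedTopological G & Group_isTopologicalGroup G}.

Section group_side.
Context {R : realType} {G : topGroupType}.

Definition group_system (H : hilbertType R) (U : G -> H -> H) :=
  [/\ forall g, unitary (U g), U 1%g = id,
      forall g h, U (g * h)%g = U g \o U h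
    & forall chi : H -> H, trace_class chi ->
        ccontinuous (fun g => tr (U g \o chi))].

Definition group_qrf (H : hilbertType R) (U : G -> H -> H)
    (E : set G -> H -> H) :=
  [/\ group_system U, is_povm setT (Bor G) E
    & forall g S, Bor G S ->
        U g \o E S \o adj (U g) = E [set (g * h)%g | h in S]].

Definition group_invariant (HS HR : hilbertType R) (T : tensor_product HS HR)
    (V : G -> HS -> HS) (U : G -> HR -> HR) : set (T -> T) :=
  [set B | bounded_op B /\
    forall g, B \o tensor_op T T (V g) (U g) = tensor_op T T (V g) (U g) \o B].

Definition Yen (HS HR : hilbertType R) (T : tensor_product HS HR)
    (V : G -> HS -> HS) (E : set G -> HR -> HR) (A : HS -> HS) : T -> T :=
  povm_integral T setT (fun g => V g \o A \o adj (V g)) E.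

Definition Yen_state (HS HR : hilbertType R) (V : G -> HS -> HS)
    (E : set G -> HR -> HR) (w : HR -> HR) (A : HS -> HS) : HS -> HS :=
  op_integral (born setT E w) setT (fun g => V g \o A \o adj (V g)).

End group_side.
Arguments Yen {R G HS HR} T V E A _.
Arguments group_invariant {R G HS HR} T V U _.

(* [comp a b] is a total function, relevant only when [src a = trg b]. *)
Record groupoid := Groupoid {
  base : ptopologicalType;
  arr : ptopologicalType;
  src : arr -> base;
  trg : arr -> base;
  unit_at : base -> arr;
  comp : arr -> arr -> arr;
  inva : arr -> arr;
  src_unit : forall x, src (unit_at x) = x;
  trg_unit : forall x, trg (unit_at x) = x;
  src_comp : forall a b, src a = trg b -> src (comp a b) = src b;
  trg_comp : forall a b, src a = trg b -> trg (comp a b) = trg a;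
  src_inv : forall a, src (inva a) = trg a;
  trg_inv : forall a, trg (inva a) = src a;
  compA : forall a b c, src a = trg b -> src b = trg c ->
    comp a (comp b c) = comp (comp a b) c;
  comp_unitl : forall a, comp (unit_at (trg a)) a = a;
  comp_unitr : forall a, comp a (unit_at (src a)) = a;
  comp_invl : forall a, comp (inva a) a = unit_at (src a);
  comp_invr : forall a, comp a (inva a) = unit_at (trg a);
  src_continuous : continuous src;
  trg_continuous : continuous trg;
  unit_continuous : continuous unit_at;
  inv_continuous : continuous inva;
  comp_continuous : {within [set p : arr * arr | src p.1 = trg p.2],
    continuous (fun p => comp p.1 p.2)};
  base_hausdorff : hausdorff_space base;
  base_locally_compact : locally_compact [set: base];
  base_second_countable : @second_countable base;
  arr_hausdorff : hausdorff_space arr;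
  arr_locally_compact : locally_compact [set: arr];
  arr_second_countable : @second_countable arr
}.

(* A family of Hilbert spaces together with a distinguished set of sections,
   its continuous sections. *)
Record hfield (R : realType) (M : Type) := HField {
  fibre :> M -> hilbertType R;
  csec : set (forall x, fibre x)
}.
Arguments csec {R M} h _.

(* Transport of vectors and operators between fibres over equal points. *)
Definition vcast (R : realType) (M : Type) (H : hfield R M) (x y : M)
    (e : x = y) (v : H x) : H y :=
  eq_rect x (fun z => fibre H z : Type) v y e.

Definition opcast (R : realType) (M : Type) (H : hfield R M) (x y : M)
    (e : x = y) (A : H x -> H x) : H y -> H y :=
  eq_rect x (fun z => fibre H z -> fibre H z) A y e.

Section fields.
Context {R : realType} {M : ptopologicalType}.

Definition continuous_field (H : hfield R M) :=
  [/\ csec H (fun x => 0),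
      forall (a : R[i]) xi eta, csec H xi -> csec H eta ->
        csec H (fun x => a *: xi x + eta x),
      forall xi, csec H xi -> continuous (fun x => hnorm (xi x)),
      forall x, dense [set xi x | xi in csec H]
    & forall zeta : forall x, H x,
        (forall (x0 : M) (e : R), 0 < e -> exists2 xi, csec H xi &
          \forall x \near x0, hnorm (zeta x - xi x) < e) ->
        csec H zeta].

(* The field of tensor products; its continuous sections are the locally
   uniform limits of finite sums of sections xi (x) eta. *)
Definition boxtimes (HS HR : hfield R M)
    (T : forall x, tensor_product (HS x) (HR x)) : hfield R M :=
  @HField R M (fun x => tcar (T x)) [set zeta |
    forall (x0 : M) (e : R), 0 < e ->
    exists (n : nat) (xi : 'I_n -> forall x, HS x) (eta : 'I_n -> forall x, HR x),
      [/\ forall j, csec HS (xi j), forall j, csec HR (eta j)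
        & \forall x \near x0,
            hnorm (zeta x - \sum_j ten (T x) (xi j x) (eta j x)) < e]].

Definition op_field (H : hfield R M) := forall x, H x -> H x.

Definition measurable_op_field (H : hfield R M) (A : op_field H) :=
  forall xi eta, csec H xi -> csec H eta ->
    cmeasurable (fun x => dot (xi x) (A x (eta x))).

Context (mu : {measure set (borel M) -> \bar R}).

Definition ae_eq_field (H : hfield R M) (A B : op_field H) :=
  {ae mu, forall x, A x = B x}.

(* Elements of the direct integrals below are classes modulo mu-a.e. equality. *)
Definition ae_class (H : hfield R M) (A : op_field H) : set (op_field H) :=
  [set B | ae_eq_field A B].

Definition ess_bounded (H : hfield R M) (A : op_field H) :=
  exists C : R, {ae mu, forall x, forall v, hnorm (A x v) <= C * hnorm v}.

Definition is_Afield (H : hfield R M) (A : op_field H) :=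
  [/\ forall x, bounded_op (A x), measurable_op_field A & ess_bounded A].

Definition Afields (H : hfield R M) : set (set (op_field H)) :=
  [set ae_class A | A in @is_Afield H].

Definition Sfields (H : hfield R M) : set (set (op_field H)) :=
  [set ae_class w | w in [set w | @is_Afield H w /\
    {ae mu, forall x, density (w x)}]].

Definition Dfields (H : hfield R M) : set (set (op_field H)) :=
  [set ae_class rho | rho in [set rho : op_field H |
    [/\ forall x, positive_op (rho x) /\ trace_class (rho x),
        measurable_op_field rho
      & integral mu setT (fun x => (complex.Re (tr (rho x)))%:E) = 1%E]]].

End fields.
Arguments Afields {R M} mu H _.
Arguments Sfields {R M} mu H _.
Arguments Dfields {R M} mu H _.

Section groupoid_side.
Context {R : realType} (Gam : groupoid).
Local Notation M := (base Gam).

Definition tfib (x : M) : set (arr Gam) := [set b | trg b = x].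

Definition arrow_ops (H : hfield R M) :=
  forall a : arr Gam, H (src a) -> H (trg a).

Definition unitary_rep (H : hfield R M) (U : arrow_ops H) :=
  [/\ forall a, unitary (U a),
      forall a b (e : src a = trg b) (v : H (src b)),
        U (comp a b) (vcast (esym (src_comp e)) v) =
        vcast (esym (trg_comp e)) (U a (vcast (esym e) (U b v))),
      forall x (v : H x),
        U (unit_at x) (vcast (esym (src_unit x)) v) =
        vcast (esym (trg_unit x)) v
    & forall xi eta, csec H xi -> csec H eta ->
        cmeasurable (fun a => dot (xi (trg a)) (U a (eta (src a))))].

(* The fields chi_a in T(H^(t(a)), H^(s(a))) that are locally trace-norm uniform
   limits of fields sum_j |xi^j_(s(a))><eta^j_(t(a))|. *)
Definition continuous_trace_field (H : hfield R M)
    (chi : forall a : arr Gam, H (trg a) -> H (src a)) :=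
  (forall a, trace_class (chi a)) /\
  forall a0 : arr Gam, exists2 W, nbhs a0 W & forall e : R, 0 < e ->
    exists (n : nat) (xi eta : 'I_n -> forall x, H x),
      [/\ forall j, csec H (xi j), forall j, csec H (eta j)
        & forall a, W a ->
            (trace_norm (fun v => chi a v -
              \sum_j ketbra (xi j (src a)) (eta j (trg a)) v)%R < e%:E)%E].

Definition fibrewise_uw_continuous (H : hfield R M) (U : arrow_ops H) :=
  forall chi, continuous_trace_field chi ->
    ccontinuous (fun a => tr (U a \o chi a)).

Definition groupoid_system (H : hfield R M) (V : arrow_ops H) :=
  [/\ continuous_field H, unitary_rep V & fibrewise_uw_continuous V].

Definition groupoid_povms (H : hfield R M) :=
  forall x : M, set (arr Gam) -> H x -> H x.

Definition measurable_povms (H : hfield R M) (E : groupoid_povms H) :=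
  forall S, Bor (arr Gam) S -> forall xi eta, csec H xi -> csec H eta ->
    cmeasurable (fun x => dot (xi x) (E x (S `&` tfib x) (eta x))).

Definition groupoid_qrf (H : hfield R M) (U : arrow_ops H)
    (E : groupoid_povms H) :=
  [/\ groupoid_system U,
      forall x, is_povm (tfib x) (Bor_on (tfib x)) (E x),
      measurable_povms E
    & forall a S, Bor_on (tfib (src a)) S ->
        U a \o E (src a) S \o adj (U a) = E (trg a) [set comp a b | b in S]].

Context (mu : {measure set (borel M) -> \bar R}).

Definition admissible (H : hfield R M) (E : groupoid_povms H) :=
  {ae mu, forall x, forall N, Bor M N -> mu N = 0%E ->
    E x (@src Gam @^-1` N `&` tfib x) = (fun=> 0)}.

Definition Afields_inv (HS HR : hfield R M)
    (T : forall x, tensor_product (HS x) (HR x))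
    (V : arrow_ops HS) (U : arrow_ops HR) : set (set (op_field (boxtimes T))) :=
  [set ae_class mu B | B in [set B : op_field (boxtimes T) |
    is_Afield mu B /\ forall a,
      tensor_op (T (src a)) (T (trg a)) (V a) (U a) \o B (src a) \o
        adj (tensor_op (T (src a)) (T (trg a)) (V a) (U a)) = B (trg a)]].

(* The integrand V_b A_(s(b)) V_b^*, viewed as an operator on H^x for b in
   t^-1(x) and extended by zero. *)
Definition conj_op (H : hfield R M) (V : arrow_ops H) (A : op_field H)
    (x : M) (b : arr Gam) : H x -> H x :=
  match pselect (trg b = x) with
  | left e => opcast e (V b \o A (src b) \o adj (V b))
  | right _ => fun=> 0
  end.

Definition rel_field (HS HR : hfield R M)
    (T : forall x, tensor_product (HS x) (HR x)) (V : arrow_ops HS)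
    (E : groupoid_povms HR) (A : op_field HS) : op_field (boxtimes T) :=
  fun x => povm_integral (T x) (tfib x) (conj_op V A (x := x)) (E x).
Arguments rel_field {HS HR} T V E A _.

Definition rel_state_field (HS HR : hfield R M) (V : arrow_ops HS)
    (E : groupoid_povms HR) (w : op_field HR) (A : op_field HS) : op_field HS :=
  fun x => op_integral (born (tfib x) (E x) (w x)) (tfib x)
    (conj_op V A (x := x)).

(* The relativization maps act on classes modulo mu-a.e. equality. *)
Definition Rel (HS HR : hfield R M)
    (T : forall x, tensor_product (HS x) (HR x)) (V : arrow_ops HS)
    (E : groupoid_povms HR) (CA : set (op_field HS)) :
    set (op_field (boxtimes T)) :=
  [set B | exists2 A, CA A & ae_eq_field mu (rel_field T V E A) B].

Definition Rel_state (HS HR : hfield R M) (V : arrow_ops HS)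
    (E : groupoid_povms HR) (Cw : set (op_field HR)) (CA : set (op_field HS)) :
    set (op_field HS) :=
  [set B | exists w A, [/\ Cw w, CA A
    & ae_eq_field mu (rel_state_field V E w A) B]].

End groupoid_side.
Arguments Afields_inv {R Gam} mu {HS HR} T V U _.
Arguments Rel {R Gam} mu {HS HR} T V E CA _.
Arguments Rel_state {R Gam} mu {HS HR} V E Cw CA _.

HB.instance Definition _ := hasNbhs.Build unit principal_filter.
HB.instance Definition _ := Discrete_ofNbhs.Build unit erefl.

Lemma unit_hausdorff : hausdorff_space unit.
Proof. by move=> [] []. Qed.

Lemma unit_locally_compact : locally_compact [set: unit].
Proof.
move=> x _; exists setT; first exact: filterT.
split; last exact: closedT.
have -> : [set: unit] = [set tt] by apply/seteqP; split=> [[]|].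
exact: compact_set1.
Qed.

Lemma unit_second_countable : @second_countable unit.
Proof.
exists [set setT]; first exact: countable1.
split=> [A ->|[] A]; first exact: openT.
move=> /nbhs_singleton Att; exists setT => //= [[]] //.
Qed.

Definition unit_all_tt (x : unit) : tt = x := match x with tt => erefl end.

Definition group_groupoid (G : topGroupType) (Ghd : hausdorff_space G)
    (Glc : locally_compact [set: G]) (Gsc : @second_countable G) : groupoid :=
  @Groupoid unit G (fun=> tt) (fun=> tt) (fun=> 1%g) (fun g h => (g * h)%g)
    (fun g => (g^-1)%g) unit_all_tt unit_all_tt
    (fun _ _ _ => erefl) (fun _ _ _ => erefl) (fun=> erefl) (fun=> erefl)
    (fun a b c _ _ => mulgA a b c) (@mul1g G) (@mulg1 G) (@mulVg G) (@mulgV G)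
    (fun=> cvg_cst _) (fun=> cvg_cst _) (fun=> cvg_cst _) (@invg_continuous G)
    (continuous_subspaceT (@mulg_continuous G))
    unit_hausdorff unit_locally_compact unit_second_countable Ghd Glc Gsc.

Section one_point.
Context {R : realType}.

(* Over one point every section is continuous. *)
Definition point_field (H : hilbertType R) : hfield R unit :=
  @HField R unit (fun=> H) setT.

Definition point_tensor (HS HR : hilbertType R) (T : tensor_product HS HR) :
    forall x, tensor_product (point_field HS x) (point_field HR x) :=
  fun=> T.

Definition point_mass : {measure set (borel unit) -> \bar R} :=
  dirac (tt : borel unit).

(* The identification of an operator A with the class of the field * |-> A. *)
Definition point_class (H : hfield R unit) (A : H tt -> H tt) :
    set (op_field H) :=
  ae_class point_mass (fun x => match x with tt => A end).

End one_point.

(* Main.v *)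
(* Over one point, the classes of fields modulo null sets are single
   operators, every section is continuous and every set is measurable, so the
   groupoid notions unfold to the group ones, with two exceptions. For the
   fibre-wise ultraweak continuity, a continuous trace-class field over G is
   locally close in trace norm to a constant finite-rank operator; since |tr
   (U_g X)| is at most the trace norm of X, this reduces the continuity of g
   |-> tr (U_g chi_g) to that of finitely many matrix coefficients of U.
   Conversely a constant field is approximated by truncating a nuclear
   expansion. For the invariant operators, B commutes with W = V_g (x) U_g
   exactly when W B W^* = B, because W extends to a unitary operator by
   isometry on the dense span of the simple tensors. Traces are well-defined
   because a separable Hilbert space has a Hilbert basis and the trace of a
   nuclear operator is computed by any basis. *)

Require Import Defs.
From HB Require Import structures.
From mathcomp Require Import all_boot all_order all_algebra.
From mathcomp Require Import all_classical all_reals all_analysis.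
From mathcomp Require Import measurable_realfun.
From mathcomp Require Import complex ring lra.

Set Implicit Arguments.
Unset Strict Implicit.
Unset Printing Implicit Defensive.

Import Order.TTheory GRing.Theory Num.Theory.
Import numFieldNormedType.Exports.

Local Open Scope classical_set_scope.
Local Open Scope complex_scope.
Local Open Scope ring_scope.

(** * Inner product *)

Section inner_product.
Context {R : realType} {H : hilbertType R}.
Implicit Types (u v w : H) (a : R[i]).

Lemma normE u : `|u| = (hnorm u)%:C.
Proof. by rewrite /hnorm RRe_real // ger0_real. Qed.

Lemma hnorm_ge0 u : 0 <= hnorm u.
Proof. by rewrite -lecR -normE normr_ge0. Qed.

Lemma dotDr u v w : dot u (v + w) = dot u v + dot u w.
Proof. by have := dot_linear u v w 1; rewrite scale1r mul1r. Qed.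

Lemma dot0r u : dot u 0 = 0.
Proof. by apply: (addrI (dot u 0)); rewrite -dotDr !addr0. Qed.

Lemma dotZr u a v : dot u (a *: v) = a * dot u v.
Proof. by rewrite -[a *: v]addr0 dot_linear dot0r addr0. Qed.

Lemma dotNr u v : dot u (- v) = - dot u v.
Proof. by rewrite -scaleN1r dotZr mulN1r. Qed.

Lemma dotBr u v w : dot u (v - w) = dot u v - dot u w.
Proof. by rewrite dotDr dotNr. Qed.

Lemma dot_sumr u I (s : seq I) (P : pred I) (F : I -> H) :
  dot u (\sum_(i <- s | P i) F i) = \sum_(i <- s | P i) dot u (F i).
Proof.
by elim/big_rec2: _ => [|i x y _ <-]; rewrite ?dot0r ?dotDr.
Qed.

Lemma dotDl u v w : dot (u + v) w = dot u w + dot v w.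
Proof. by rewrite !(dot_conj w) dotDr rmorphD. Qed.

Lemma dot0l u : dot 0 u = 0.
Proof. by rewrite dot_conj dot0r rmorph0. Qed.

Lemma dotZl a u v : dot (a *: u) v = Num.conj a * dot u v.
Proof. by rewrite !(dot_conj v) dotZr rmorphM. Qed.

Lemma dotNl u v : dot (- u) v = - dot u v.
Proof. by rewrite !(dot_conj v) dotNr rmorphN. Qed.

Lemma dotBl u v w : dot (u - v) w = dot u w - dot v w.
Proof. by rewrite dotDl dotNl. Qed.

Lemma dot_suml u I (s : seq I) (P : pred I) (F : I -> H) :
  dot (\sum_(i <- s | P i) F i) u = \sum_(i <- s | P i) dot (F i) u.
Proof.
by elim/big_rec2: _ => [|i x y _ <-]; rewrite ?dot0l ?dotDl.
Qed.

Lemma dot_eq0 u : (forall v, dot v u = 0) -> u = 0.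
Proof.
by move/(_ u)/eqP; rewrite dot_norm sqrf_eq0 normr_eq0 => /eqP.
Qed.

(** The squared norm of [|u|^2 v - <u,v> u] expands to [|u|^2 (|u|^2 |v|^2 - |<u,v>|^2)]. It is
    nonnegative, and the factor [|u|^2] cancels when [u] is nonzero. *)
Lemma cauchy_schwarz u v : `|dot u v| <= `|u| * `|v|.
Proof.
have [->|u0] := eqVneq u 0; first by rewrite dot0l normr0 mulr_ge0.
have n0 : 0 < `|u| ^+ 2 by rewrite exprn_gt0 ?normr_gt0.
rewrite -(@ler_pXn2r _ 2) ?nnegrE ?mulr_ge0 // exprMn.
have := exprn_ge0 2 (normr_ge0 (`|u| ^+ 2 *: v - dot u v *: u)).
rewrite -dot_norm dotBl !dotBr !dotZl !dotZr !dot_norm (dot_conj u v).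
rewrite (geC0_conj (ltW n0)).
set n := `|u| ^+ 2 in n0 *; set d := dot u v.
rewrite (_ : _ - _ = n * (n * `|v| ^+ 2 - d * Num.conj d)); last by ring.
by rewrite pmulr_rge0 // subr_ge0 -normCK.
Qed.

Lemma cauchy_schwarzR u v : `|dot u v| <= (hnorm u * hnorm v)%:C.
Proof. by rewrite rmorphM /= -!normE cauchy_schwarz. Qed.

End inner_product.

Lemma cvg_dominated (K : numFieldType) (V W : normedModType K) (T : Type)
    (F : set_system T) {FF : Filter F} (f : T -> V) (l : V) (g : T -> W)
    (m : W) (C : K) :
  0 <= C -> (forall x, `|l - f x| <= C * `|m - g x|) ->
  g @ F --> m -> f @ F --> l.
Proof.
move=> C0 fg /cvgrPdist_lt gm; apply/cvgrPdist_lt => e e0.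
(* [C] may be zero, so the division below is by [C + 1]. *)
have C1 : 0 < C + 1 by rewrite ltr_wpDl.
near=> x; apply: (le_lt_trans (fg x)).
apply: (@le_lt_trans _ _ ((C + 1) * `|m - g x|)).
  by rewrite ler_wpM2r // lerDl.
rewrite mulrC -ltr_pdivlMr //; near: x.
by apply: gm; rewrite divr_gt0.
Unshelve. all: by end_near. Qed.

(** * Continuity of the inner product and elementary rules for linear maps *)

Section limits.
Context {R : realType} {H : hilbertType R}.
Implicit Types (u v w : H) (a : R[i]).

Lemma dot_cvgr T (F : set_system T) {FF : Filter F} (f : T -> H) u v :
  f @ F --> v -> (fun x => dot u (f x) : R[i]^o) @ F --> (dot u v : R[i]^o).
Proof.
apply: (cvg_dominated (C := `|u|)) => // x.
by rewrite -dotBr; exact: cauchy_schwarz.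
Qed.

Lemma cvgc_unique (f : nat -> R[i]^o) (a b : R[i]^o) :
  f @ \oo --> a -> f @ \oo --> b -> a = b.
Proof. exact: cvg_unique. Qed.

Lemma dot_series u (f : nat -> H) n :
  dot u (series f n) = series (fun k => dot u (f k) : R[i]^o) n.
Proof. by rewrite /series /= dot_sumr. Qed.

Lemma dot_csum u (f : nat -> H) v :
  series f @ \oo --> v -> csum (fun k => dot u (f k)) (dot u v).
Proof.
move=> /(dot_cvgr (u := u)); rewrite /csum.
by under eq_fun do rewrite dot_series.
Qed.

Lemma linear_op (K : hilbertType R) (T : H -> K) : linear T ->
  [/\ T 0 = 0, forall u v, T (u + v) = T u + T v,
      forall u v, T (u - v) = T u - T v & forall a u, T (a *: u) = a *: T u].
Proof.
move=> lT; have TD u v : T (u + v) = T u + T v.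
  by have := lT 1 u v; rewrite !scale1r.
have T0 : T 0 = 0 by apply: (addrI (T 0)); rewrite -TD !addr0.
have TZ a u : T (a *: u) = a *: T u by rewrite -[a *: u]addr0 lT T0 addr0.
by split=> // u v; rewrite TD -scaleN1r TZ scaleN1r.
Qed.

End limits.

(** * Hilbert bases *)

Section projections.
Context {R : realType} {H : hilbertType R}.
Implicit Types (u v w : H) (e : nat -> H).

(** The clauses of [hilbert_basis] other than completeness. Zero vectors are allowed because
    Gram-Schmidt yields one at each linearly dependent step. *)
Definition orthonormal_or_zero e :=
  (forall m n, m != n -> dot (e m) (e n) = 0) /\
  forall n, e n = 0 \/ hnorm (e n) = 1.

Definition partial_proj e (n : nat) v : H :=
  \sum_(0 <= k < n) dot (e k) v *: e k.

Lemma partial_projB e n u v :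
  partial_proj e n (u - v) = partial_proj e n u - partial_proj e n v.
Proof.
rewrite /partial_proj -sumrB; apply: eq_bigr => k _.
by rewrite dotBr scalerBl.
Qed.

Section orthonormal.
Context (e : nat -> H) (e_on : orthonormal_or_zero e).

Lemma dot_scale_id n : dot (e n) (e n) *: e n = e n.
Proof.
have [->|en] := e_on.2 n; first by rewrite scaler0.
by rewrite dot_norm normE en expr1n scale1r.
Qed.

Lemma partial_proj_id k n : (k < n)%N -> partial_proj e n (e k) = e k.
Proof.
move=> kn; rewrite /partial_proj (bigD1_seq k) ?mem_index_iota ?iota_uniq //=.
rewrite dot_scale_id big1 ?addr0 // => j jk.
by rewrite e_on.1 // scale0r.
Qed.

(** Gives the idempotence of the projections when [m = n], and for [m <= n] that later projections
    keep what an earlier one fixes. *)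
Lemma partial_proj_sum n m (c : nat -> R[i]) : (m <= n)%N ->
  partial_proj e n (\sum_(0 <= k < m) c k *: e k) =
  \sum_(0 <= k < m) c k *: e k.
Proof.
move=> mn; rewrite {1}/partial_proj.
under eq_bigr do rewrite dot_sumr scaler_suml.
rewrite exchange_big /= big_seq [RHS]big_seq; apply: eq_bigr => k.
rewrite mem_index_iota => /= km.
rewrite -[in RHS](partial_proj_id (leq_trans km mn)) scaler_sumr.
by apply: eq_bigr => j _; rewrite dotZr scalerA.
Qed.

Lemma partial_proj_dot n u v :
  dot u (partial_proj e n v) = dot (partial_proj e n u) v.
Proof.
rewrite dot_sumr dot_suml; apply: eq_bigr => k _.
by rewrite dotZr dotZl (dot_conj (e k) u) mulrC.
Qed.

(** The projection is symmetric and idempotent, so the cross terms cancel. *)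
Lemma partial_proj_pythagoras n v :
  `|v| ^+ 2 = `|partial_proj e n v| ^+ 2 + `|v - partial_proj e n v| ^+ 2.
Proof.
have PP : partial_proj e n (partial_proj e n v) = partial_proj e n v.
  exact: partial_proj_sum.
rewrite -!dot_norm dotBl !dotBr (partial_proj_dot n v v).
by rewrite (partial_proj_dot n (partial_proj e n v)) PP; ring.
Qed.

Lemma norm_sub_partial_proj n v : `|v - partial_proj e n v| <= `|v|.
Proof.
rewrite -(@ler_pXn2r _ 2) ?nnegrE // [leRHS](partial_proj_pythagoras n).
by rewrite lerDr exprn_ge0.
Qed.

(* The projection onto the span of e_0, ..., e_(N-1) fixes d_n for N > n, so
   that v - P_N v = (1 - P_N) (v - d_n) is at most |v - d_n|. *)
Lemma dense_span_basis (d : nat -> H) : dense (range d) ->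
  (forall n, partial_proj e n.+1 (d n) = d n) -> hilbert_basis e.
Proof.
move=> dd de; split; [exact: e_on.1|exact: e_on.2|move=> v].
apply/cvgrPdist_lt => eps eps0.
have [] := dd (ball v eps).
- by exists v; exact: ballxx.
- exact: ball_open.
move=> x [/= + [n _ dx]]; rewrite -dx -ball_normE /= => vd.
exists n.+1 => //= N /= nN; apply: le_lt_trans vd.
have -> : series (fun n => dot (e n) v *: e n) N = partial_proj e N v by [].
have dN : partial_proj e N (d n) = d n.
  by rewrite -(de n); exact: partial_proj_sum.
have <- : v - d n - partial_proj e N (v - d n) = v - partial_proj e N v.
  by rewrite partial_projB dN opprB addrA subrK.
exact: norm_sub_partial_proj.
Qed.

End orthonormal.

(** The whole list of earlier vectors is carried along, since each step subtracts the components
    along all of them. If [d m] depends on them, then [w = 0] and a zero vector is appended. *)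
Fixpoint gram_schmidt_seq (d : nat -> H) (n : nat) : seq H :=
  if n is m.+1 then
    let s := gram_schmidt_seq d m in
    let w := d m - \sum_(u <- s) dot u (d m) *: u in rcons s (`|w|^-1 *: w)
  else [::].

Definition gram_schmidt (d : nat -> H) n : H :=
  nth 0 (gram_schmidt_seq d n.+1) n.

Lemma gram_schmidt_seqE d n :
  gram_schmidt_seq d n = mkseq (gram_schmidt d) n.
Proof.
have sz m : size (gram_schmidt_seq d m) = m.
  by elim: m => //= m IH; rewrite size_rcons IH.
elim: n => // n IH; rewrite mkseqS -IH /gram_schmidt /=.
by rewrite nth_rcons sz ltnn eqxx.
Qed.

Lemma gram_schmidtE d n (w := d n - partial_proj (gram_schmidt d) n (d n)) :
  gram_schmidt d n = `|w|^-1 *: w.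
Proof.
rewrite {1}/gram_schmidt /= nth_rcons gram_schmidt_seqE size_mkseq ltnn eqxx.
by rewrite /w /partial_proj /mkseq big_map /index_iota subn0.
Qed.

Lemma gram_schmidt_orthonormal d : orthonormal_or_zero (gram_schmidt d).
Proof.
set e := gram_schmidt d.
have en n : e n = 0 \/ hnorm (e n) = 1.
  rewrite /e gram_schmidtE; set w := _ - _.
  have [->|w0] := eqVneq w 0; [left; exact: scaler0|right].
  by rewrite /hnorm normrZ normfV normr_id mulVf ?normr_eq0.
(* Strong induction on the larger index: for distinct [j, k < n], the orthogonality of [e j] and
   [e k] is the hypothesis at the larger of the two. *)
have eo n : forall k, (k < n)%N -> dot (e k) (e n) = 0.
  elim/ltn_ind: n => n IH k kn; rewrite {2}/e gram_schmidtE -/e.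
  rewrite dotZr dotBr dot_sumr (bigD1_seq k) ?mem_index_iota ?iota_uniq //=.
  rewrite big_seq_cond big1 ?addr0 => [|j /andP[]].
    rewrite dotZr; have [->|ek] := en k.
      by rewrite !dot0l mul0r subrr mulr0.
    rewrite [dot (e k) (e k)]dot_norm (normE (e k)) ek.
    by rewrite expr1n mulr1 subrr mulr0.
  rewrite mem_index_iota /= => jn jk; rewrite dotZr.
  have [jk'|kj|jk'] := ltngtP j k; last by rewrite jk' eqxx in jk.
    by rewrite (dot_conj (e j) (e k)) (IH k) // conjC0 mulr0.
  by rewrite (IH j) // mulr0.
split=> // m n; case: ltngtP => // mn _; first exact: eo.
by rewrite dot_conj eo // conjC0.
Qed.

(** With [w] the part of [d n] orthogonal to the earlier vectors, [e n] is [w] normalized, so the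
    last term of the projection restores exactly [w]. *)
Lemma gram_schmidt_span d n :
  partial_proj (gram_schmidt d) n.+1 (d n) = d n.
Proof.
have := gram_schmidt_orthonormal d; set e := gram_schmidt d => e_on.
rewrite {1}/partial_proj big_nat_recr //= -/(partial_proj e n (d n)).
set w := d n - partial_proj e n (d n).
have eE : e n = `|w|^-1 *: w by rewrite /e gram_schmidtE.
have -> : dot (e n) (d n) = dot (e n) w.
  rewrite dotBr -[LHS]subr0; congr (_ - _).
  rewrite dot_sumr big_seq big1 // => k; rewrite mem_index_iota /= => kn.
  by rewrite dotZr e_on.1 ?mulr0 // gtn_eqF.
suff -> : dot (e n) w *: e n = w by rewrite addrC subrK.
have [w0|w0] := eqVneq w 0; first by rewrite w0 dot0r scale0r.
rewrite {2}eE scalerA eE dotZl dot_norm geC0_conj ?invr_ge0 //.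
rewrite expr2 mulrA mulVf ?normr_eq0 // mul1r mulfV ?normr_eq0 //.
by rewrite scale1r.
Qed.

Lemma dense_range : exists d : nat -> H, dense (range d).
Proof.
have [D /countable_injP[f fi] dD] := @hilbert_separable R H.
(* A left inverse of [f] on [D]. Off the image of [f] the default is 0, which only enlarges the
   range and cannot spoil density. *)
exists (fun n => xget 0 [set v | D v /\ f v = n]).
move=> O O0 oO; have [v [Ov Dv]] := dD O O0 oO.
exists v; split => //; exists (f v) => //=.
case: xgetP => [w _ [Dw fw]|/(_ v)]; last by case.
by apply: fi fw; rewrite inE.
Qed.

Lemma hilbert_basis_exists : exists e : nat -> H, hilbert_basis e.
Proof.
have [d dd] := dense_range; exists (gram_schmidt d).
exact: (dense_span_basis (gram_schmidt_orthonormal d) dd (gram_schmidt_span d)).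
Qed.

End projections.

(** * Complex series *)

Section complex_series.
Context {R : realType}.
Implicit Types (f g : nat -> R[i]) (b : nat -> R) (z : R[i]).

(** Convergence over [R[i]] quantifies over complex [e > 0]; this turns such an [e] into a real
    one. *)
Lemma posC_real z : 0 < z -> exists2 e : R, 0 < e & z = e%:C.
Proof.
move=> z0; have zE : (complex.Re z)%:C = z by rewrite RRe_real // gtr0_real.
by exists (complex.Re z); rewrite // -ltcR zE.
Qed.

Lemma cvgc_norm_le (f : nat -> R[i]^o) (l : R[i]^o) (c : R[i]) M :
  f @ \oo --> l -> (forall n, (M <= n)%N -> `|f n| <= c) -> `|l| <= c.
Proof.
move=> /cvgrPdist_le fl fc; apply/ler_addgt0Pr => e e0.
have [N _ fN] := fl _ e0.
have := fN _ (leq_maxl N M); have := fc _ (leq_maxr N M).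
move=> A B; rewrite -[l](subrK (f (maxn N M))) addrC.
by apply: (le_trans (ler_normD _ _)); exact: lerD.
Qed.

Lemma csumD f g y z : csum f y -> csum g z -> csum (fun n => f n + g n) (y + z).
Proof.
move=> fy gz; rewrite /csum.
have -> : series (fun n => f n + g n : R[i]^o) =
    (fun n => series (f : nat -> R[i]^o) n + series (g : nat -> R[i]^o) n).
  by apply/funext => n; rewrite /series /= big_split.
by apply: (@cvgD R[i] R[i]^o); [exact: fy|exact: gz].
Qed.

Lemma csumN f y : csum f y -> csum (fun n => - f n) (- y).
Proof.
move=> fy; rewrite /csum.
have -> : series (fun n => - f n : R[i]^o) = - series f.
  by apply/funext => n; rewrite /series /= sumrN.
exact: cvgN.
Qed.

Lemma csum0 : csum (fun=> 0 : R[i]) 0.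
Proof.
rewrite /csum.
have -> : series (fun=> 0 : R[i]^o) = (fun=> 0 : R[i]^o).
  by apply/funext => n; rewrite /series /= big1.
exact: cvg_cst.
Qed.

Lemma csum_sum I (s : seq I) (F : I -> nat -> R[i]) (y : I -> R[i]) :
  (forall i, csum (F i) (y i)) ->
  csum (fun n => \sum_(i <- s) F i n) (\sum_(i <- s) y i).
Proof.
move=> Fy; elim: s => [|i s IH].
  rewrite big_nil; under eq_fun do rewrite big_nil.
  exact: csum0.
rewrite big_cons; under eq_fun do rewrite big_cons.
exact: (csumD (Fy i) IH).
Qed.

Lemma series_cvg_bounded b r : (forall n, 0 <= b n) ->
  (forall N, \sum_(0 <= n < N) b n <= r) -> cvgn (series b).
Proof.
move=> b0 br; apply: nondecreasing_is_cvgn; first exact: nondecreasing_series.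
by exists r => _ [n _ <-]; exact: br.
Qed.

(** The partial sums increase to their limit, so every finite block starting at [M] is at most the
    distance from the [M]-th partial sum to the limit. The bound is uniform in [N]. *)
Lemma series_tail_le b r e : (forall n, 0 <= b n) ->
  (forall N, \sum_(0 <= n < N) b n <= r) -> 0 < e ->
  exists M, forall N, \sum_(M <= n < N) b n <= e.
Proof.
move=> b0 br e0; have bc := series_cvg_bounded b0 br.
have /cvgrPdist_le /(_ _ e0) [M _ bM] := bc.
exists M => N; have [MN|NM] := leqP M N; last first.
  by rewrite big_geq ?(ltnW NM) // ltW.
have <- : series b N - series b M = \sum_(M <= n < N) b n.
  by rewrite sub_series MN.
have nd : {homo series b : n m / (n <= m)%N >-> n <= m}.
  exact: nondecreasing_series.
have := nondecreasing_cvgn_le nd bc N.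
have := le_trans (ler_norm _) (bM M (leqnn M)).
by rewrite -[lim _]/(limn (series b)); lra.
Qed.

Lemma csum_tail_le f b z e M : csum f z -> (forall n, `|f n| <= (b n)%:C) ->
  (forall N, \sum_(M <= n < N) b n <= e) ->
  `|z| <= \sum_(0 <= n < M) `|f n| + e%:C.
Proof.
move=> fz fb be; apply: (cvgc_norm_le (M := M) fz) => N MN.
rewrite /series /= (big_cat_nat (leq0n M) MN) //=.
apply: (le_trans (ler_normD _ _)); rewrite lerD ?ler_norm_sum //.
apply: (@le_trans _ _ (\sum_(M <= n < N) (b n)%:C)).
  by apply: (le_trans (ler_norm_sum _ _ _)); apply: ler_sum => n _; exact: fb.
by rewrite -rmorph_sum lecR; exact: be.
Qed.

(** Real and imaginary parts are dominated by [b], converge absolutely as real series, and are then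
    reassembled. *)
Lemma csum_abs_cvg f b r : (forall n, `|f n| <= (b n)%:C) ->
  (forall N, \sum_(0 <= n < N) b n <= r) -> exists z, csum f z.
Proof.
move=> fb br.
have b0 n : 0 <= b n by rewrite -lecR; exact: le_trans (normr_ge0 _) (fb n).
have bc := series_cvg_bounded b0 br.
have part_cvg (p : R[i] -> R) : (forall a, `|p a|%:C <= `|a|) ->
    exists x : R, series (fun n => p (f n)) @ \oo --> x.
  move=> pn; suff : cvgn (series (fun n => p (f n))).
    by exists (limn (series (fun n => p (f n)))).
  apply: normed_cvg; apply: (series_le_cvg _ b0 _ bc) => n /=.
    exact: normr_ge0.
  by rewrite -lecR; exact: le_trans (pn _) (fb n).
have [x xP] := part_cvg _ (@normc_ge_Re R).
have im_le (a : R[i]) : `|complex.Im a|%:C <= `|a|.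
  by rewrite normc_def lecR -sqrtr_sqr ler_wsqrtr // lerDr sqr_ge0.
have normi : `|'i : R[i]| = 1.
  by rewrite normc_def /= expr0n expr1n add0r sqrtr1.
have [y yP] := part_cvg _ im_le.
exists (x +i* y); apply/cvgrPdist_le => e /posC_real[d d0 ->].
have d2 : 0 < d / 2 by rewrite divr_gt0.
move/cvgrPdist_le : xP => /(_ _ d2) xP; move/cvgrPdist_le : yP => /(_ _ d2) yP.
near=> N.
have -> : series (f : nat -> R[i]^o) N =
    series (fun n => complex.Re (f n)) N +i*
    series (fun n => complex.Im (f n)) N.
  rewrite /series /=; elim: (N) => [|n IH]; first by rewrite !big_geq.
  by rewrite !big_nat_recr //= IH; case: (f n).
have -> (x1 x2 y1 y2 : R) :
    (x1 +i* y1) - (x2 +i* y2) = (x1 - x2)%:C + 'i * (y1 - y2)%:C.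
  by simpc.
apply: (le_trans (ler_normD _ _)); rewrite normrM normi mul1r.
rewrite !normc_def /= !expr0n /= !addr0 !sqrtr_sqr -rmorphD lecR.
rewrite [leRHS]splitr; apply: lerD; near: N; [exact: xP|exact: yP].
Unshelve. all: by end_near. Qed.

End complex_series.

(** * Trace *)

Section trace.
Context {R : realType}.
Implicit Types H K : hilbertType R.

(** [is_trace] quantifies over all Hilbert bases, so it determines its value only because at least
    one basis exists. *)
Lemma is_trace_tr H (T : H -> H) z : is_trace T z -> tr T = z.
Proof.
move=> Tz; have [e eb] := @hilbert_basis_exists R H.
rewrite /tr; case: xgetP => [y _ Ty|/(_ z)/(_ Tz)//].
exact: cvgc_unique (Ty e eb) (Tz e eb).
Qed.

Lemma is_traceD H (S T : H -> H) y z : is_trace S y -> is_trace T z ->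
  is_trace (fun v => S v + T v) (y + z).
Proof.
move=> Sy Tz e eb; under eq_fun do rewrite dotDr.
exact: (csumD (Sy e eb) (Tz e eb)).
Qed.

Lemma is_trace_sum H I (s : seq I) (T : I -> H -> H) (z : I -> R[i]) :
  (forall i, is_trace (T i) (z i)) ->
  is_trace (fun v => \sum_(i <- s) T i v) (\sum_(i <- s) z i).
Proof.
move=> Tz e eb; under eq_fun do rewrite dot_sumr.
by apply: csum_sum => i; exact: Tz.
Qed.

(** Parseval: pair the expansion of [u] in the basis with [v]. *)
Lemma is_trace_ketbra H (u v : H) : is_trace (ketbra u v) (dot v u).
Proof.
move=> e [_ _ eb]; have := dot_csum (u := v) (eb u).
by under eq_fun do rewrite dotZr mulrC -dotZr.
Qed.

(** Real-valued form of the expansions in [trace_norm]: a bound on all partial sums replaces the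
    extended real sum. *)
Definition nuclear H K (T : H -> K) (xi : nat -> K) (eta : nat -> H) (r : R) :=
  (forall v, series (fun n => ketbra (xi n) (eta n) v) @ \oo --> T v) /\
  forall N, \sum_(0 <= n < N) hnorm (xi n) * hnorm (eta n) <= r.

Lemma trace_norm_nuclear H K (T : H -> K) (x : \bar R) :
  (trace_norm T < x)%E -> exists xi eta r, nuclear T xi eta r /\ (r%:E < x)%E.
Proof.
move=> /ereal_inf_lt[_ [xi [eta [Txe ->]]] sx].
have b0 n : (0 <= (hnorm (xi n) * hnorm (eta n))%:E)%E.
  by rewrite lee_fin mulr_ge0 ?hnorm_ge0.
set s := (\sum_(0 <= n <oo) _)%E in sx.
have s0 : (0 <= s)%E by apply: nneseries_ge0 => n _ _; exact: b0.
have sfin : s \is a fin_num.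
  by rewrite ge0_fin_numE // (lt_le_trans sx) ?leey.
exists xi, eta, (fine s); split; last by rewrite fineK.
split=> // N; rewrite -lee_fin -sumEFin fineK //.
by apply: nneseries_lim_ge => n _ _; exact: b0.
Qed.

Lemma nuclear_trace_norm H K (T : H -> K) xi eta r :
  nuclear T xi eta r -> (trace_norm T <= r%:E)%E.
Proof.
move=> [Txe br]; apply: ge_ereal_inf.
exists (\sum_(0 <= n <oo) (hnorm (xi n) * hnorm (eta n))%:E)%E.
  by exists xi, eta.
apply: lime_le; last by apply: nearW => N; rewrite sumEFin lee_fin.
by apply: is_cvg_nneseries => n _ _; rewrite lee_fin mulr_ge0 ?hnorm_ge0.
Qed.

Lemma nuclear_comp H K (U : K -> K) (T : H -> K) xi eta r : linear U ->
  (forall v, `|U v| = `|v|) -> nuclear T xi eta r ->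
  nuclear (U \o T) (U \o xi) eta r.
Proof.
move=> /linear_op[U0 UD UB UZ] Un [Txe br]; split=> [v|N]; last first.
  by under eq_bigr do rewrite /hnorm /= Un; exact: br.
apply: (cvg_dominated (C := 1) _ _ (Txe v)) => // n.
have -> : series (fun k => ketbra ((U \o xi) k) (eta k) v) n =
    U (series (fun k => ketbra (xi k) (eta k) v) n).
  rewrite /series /=; elim: n => [|n IH]; first by rewrite !big_geq.
  by rewrite !big_nat_recr //= UD -IH /ketbra UZ.
by rewrite mul1r /= -UB Un.
Qed.

(* Splitting the two sums at M: the tail n >= M is controlled by the nuclear
   sum uniformly in N, the finitely many n < M by the convergence of the
   projections P_N (xi_n) to xi_n. *)
Lemma nuclear_is_trace H (T : H -> H) xi eta r : nuclear T xi eta r ->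
  exists2 z, is_trace T z & `|z| <= r%:C.
Proof.
move=> [Txe br]; set b := fun n => hnorm (xi n) * hnorm (eta n).
have b0 n : 0 <= b n by rewrite mulr_ge0 ?hnorm_ge0.
have cs u n : `|u| <= `|xi n| -> `|dot (eta n) u| <= (b n)%:C.
  move=> un; apply: (le_trans (cauchy_schwarz _ _)).
  by rewrite mulrC rmorphM /= -!normE ler_wpM2r.
have [z zP] := csum_abs_cvg (fun n => cs _ n (lexx _)) br.
exists z => [e eb|]; last first.
  have := csum_tail_le (M := 0%N) zP (fun n => cs _ n (lexx _)) br.
  by rewrite big_geq // add0r.
have e_on : orthonormal_or_zero e by case: eb.
(* Exchanging the finite sum over [k] with the series over [n] writes the error of the [N]-th
   partial trace as one series, whose terms are again bounded by [b n]. *)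
have partial N : csum (fun n => dot (eta n) (xi n - partial_proj e N (xi n)))
    (z - \sum_(0 <= k < N) dot (e k) (T (e k))).
  under eq_fun do rewrite dotBr.
  apply: (csumD zP); apply: csumN.
  under eq_fun do rewrite /partial_proj dot_sumr.
  apply: csum_sum => k; have := dot_csum (u := e k) (Txe (e k)).
  by under eq_fun do rewrite /ketbra dotZr mulrC -dotZr.
apply/cvgrPdist_le => d /posC_real[c c0 ->].
have c2 : 0 < c / 2 by rewrite divr_gt0.
have [M bM] := series_tail_le b0 br c2.
have eM0 n : (fun N => hnorm (eta n) *
    hnorm (xi n - partial_proj e N (xi n))) @ \oo --> (0 : R).
  apply/cvgrPdist_le => d' d'0.
  (* [eta n] may vanish, hence the [+ 1] in the denominator. *)
  have d1 : 0 < d' / (hnorm (eta n) + 1).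
    by rewrite divr_gt0 // ltr_wpDl ?hnorm_ge0.
  have d1C : 0 < (d' / (hnorm (eta n) + 1))%:C by rewrite ltcR.
  have /cvgrPdist_le/(_ _ d1C) := let: And3 _ _ eP := eb in eP (xi n).
  apply: filterS => N; rewrite -/(partial_proj e N (xi n)) normE lecR => ed.
  rewrite sub0r normrN ger0_norm ?mulr_ge0 ?hnorm_ge0 //.
  rewrite ler_pdivlMr ?ltr_wpDl ?hnorm_ge0 // in ed.
  apply: le_trans ed; rewrite mulrC ler_wpM2l ?hnorm_ge0 //.
  by rewrite lerDl.
have eM : (fun N => \sum_(0 <= n < M) hnorm (eta n) *
    hnorm (xi n - partial_proj e N (xi n))) @ \oo --> (0 : R).
  have := @cvg_big R nat +%R 0 xpredT (@add_continuous R) nat \oo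
    (index_iota 0 M) _ (fun=> 0) _ (fun n _ => eM0 n).
  by rewrite big1 => [|//]; apply; exact: eventually_filter.
move/cvgrPdist_le : eM => /(_ _ c2); apply: filterS => N.
rewrite sub0r normrN => eN.
have := csum_tail_le (partial N)
  (fun n => cs _ n (norm_sub_partial_proj e_on N (xi n))) bM.
move=> /le_trans; apply.
rewrite [in leRHS](splitr c) rmorphD lerD //.
apply: (@le_trans _ _ (\sum_(0 <= n < M) hnorm (eta n) *
    hnorm (xi n - partial_proj e N (xi n)))%:C).
  by rewrite rmorph_sum; apply: ler_sum => n _; exact: cauchy_schwarzR.
by rewrite lecR (le_trans (ler_norm _)).
Qed.

Lemma trace_class_is_trace H (T : H -> H) : trace_class T -> is_trace T (tr T).
Proof.
move=> [_ /trace_norm_nuclear[xi [eta [r [/nuclear_is_trace[z Tz _] _]]]]].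
by rewrite (is_trace_tr Tz).
Qed.

Lemma nuclear_ketbra H K (u : K) (v : H) : nuclear (ketbra u v)
  (fun n => if n is 0 then u else 0) (fun n => if n is 0 then v else 0)
  (hnorm u * hnorm v).
Proof.
have hn0 (L : hilbertType R) : hnorm (0 : L) = 0 by rewrite /hnorm normr0.
split=> [w|N].
  rewrite -(cvg_shiftS); apply: cvg_near_cst; apply: nearW => n.
  rewrite /series /= big_nat_recl //= big1 ?addr0 // => k _.
  by rewrite /ketbra scaler0.
case: N => [|N]; first by rewrite big_geq // mulr_ge0 ?hnorm_ge0.
rewrite big_nat_recl //= big1 ?addr0 // => k _.
by rewrite hn0 mul0r.
Qed.

Lemma bounded_ketbra H K (u : K) (v : H) : bounded_op (ketbra u v).
Proof.
split=> [a w w'|]; first by rewrite /ketbra dot_linear scalerDl scalerA.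
exists (hnorm v * hnorm u) => w; rewrite -lecR -normE normrZ.
rewrite !rmorphM /= -!normE mulrAC ler_wpM2r //.
exact: cauchy_schwarz.
Qed.

Lemma trace_class_ketbra H K (u : K) (v : H) : trace_class (ketbra u v).
Proof.
split; first exact: bounded_ketbra.
exact: le_lt_trans (nuclear_trace_norm (nuclear_ketbra u v)) (ltry _).
Qed.

(** A nuclear expansion is cut at [M]; the remainder is expanded by the shifted sequences, whose
    nuclear sum is a tail of a convergent series. Bounding it by [e / 2] makes the final inequality
    strict. *)
Lemma trace_class_approx H K (T : H -> K) (e : R) : trace_class T -> 0 < e ->
  exists n (xi : 'I_n -> K) (eta : 'I_n -> H),
    (trace_norm (fun v => T v - \sum_j ketbra (xi j) (eta j) v)%R < e%:E)%E.
Proof.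
move=> [_ /trace_norm_nuclear[xi [eta [r [[Txe br] _]]]]] e0.
set b := fun n => hnorm (xi n) * hnorm (eta n).
have b0 n : 0 <= b n by rewrite mulr_ge0 ?hnorm_ge0.
have e2 : 0 < e / 2 by rewrite divr_gt0.
have [M bM] := series_tail_le b0 br e2.
exists M, xi, eta; apply: (@le_lt_trans _ _ (e / 2)%:E); last first.
  by rewrite lte_fin; lra.
apply: (@nuclear_trace_norm _ _ _ (fun n => xi (n + M)%N)
  (fun n => eta (n + M)%N)); split=> [v|N]; last first.
  by have := bM (N + M)%N; rewrite -{1}[M]add0n big_addn addnK.
rewrite -(big_mkord xpredT (fun j => ketbra (xi j) (eta j) v)).
set f := fun n => ketbra (xi n) (eta n) v.
have -> : series (fun n => ketbra (xi (n + M)%N) (eta (n + M)%N) v) =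
    (fun n => series f (n + M)%N - series f M).
  apply/funext => N; rewrite sub_series leq_addl /series /=.
  rewrite [RHS](_ : _ = \sum_(0 + M <= k < N + M) f k) //.
  by rewrite big_addn addnK.
apply: cvgB; last exact: cvg_cst.
by rewrite (cvg_shiftn M); exact: Txe.
Qed.

(** The partial sums are nonnegative, hence real, and so is their limit. This recovers the full
    condition [tr w = 1] from [Dfields], where only the real part of the trace is integrated. *)
Lemma tr_density_real H (w : H -> H) :
  positive_op w -> trace_class w -> complex.Im (tr w) = 0.
Proof.
move=> [_ w0] /trace_class_is_trace wt.
have [e eb] := @hilbert_basis_exists R H.
have /cvgrPdist_lt we := wt e eb.
have sIm N : complex.Im (series (fun n => dot (e n) (w (e n)) : R[i]^o) N) = 0.
  have : 0 <= series (fun n => dot (e n) (w (e n)) : R[i]^o) N.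
    by apply: sumr_ge0 => n _; exact: w0.
  by rewrite lecE => /andP[/eqP].
apply/eqP; rewrite -normr_le0; apply/ler_addgt0Pr => d d0; rewrite add0r.
have dC : 0 < d%:C :> R[i] by rewrite ltcR.
have [N _ /(_ N (leqnn N)) wN] := we _ dC.
rewrite -lecR; apply: le_trans (ltW wN).
rewrite normc_def lecR -sqrtr_sqr ler_wsqrtr //.
move: (sIm N); case: (tr w) => a1 a2; case: (series _ N) => c1 c2 /= ->.
by rewrite subr0 lerDr sqr_ge0.
Qed.

End trace.

(** * Unitary operators and tensor products *)

Section unitaries.
Context {R : realType}.
Implicit Types H K : hilbertType R.

Lemma unitary_norm H K (T : H -> K) : unitary T -> forall v, `|T v| = `|v|.
Proof.
move=> [_ Td _] v; apply/eqP; rewrite -(@eqrXn2 _ 2) //.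
by rewrite -!dot_norm Td.
Qed.

Lemma unitary_bounded H K (T : H -> K) : unitary T -> bounded_op T.
Proof.
move=> uT; case: (uT) => lT _ _; split=> //; exists 1 => v.
by rewrite mul1r /hnorm unitary_norm.
Qed.

Lemma adj_unitary H K (T : H -> K) : unitary T ->
  cancel T (adj T) /\ cancel (adj T) T.
Proof.
move=> uT; case: (uT) => lT Td Ts; have [T0 TD TB TZ] := linear_op lT.
have Tinj v v' : T v = T v' -> v = v'.
  move=> vv'; apply/eqP; rewrite -subr_eq0 -normr_eq0 -(unitary_norm uT) TB.
  by rewrite vv' subrr normr0.
(* A section of the surjection [T] is bounded and adjoint to [T], so the set from which [adj]
   chooses is inhabited. *)
have [S ST] := choice Ts.
have [_ adjT] : bounded_op (adj T) /\
    forall u v, dot (T u) v = dot u (adj T v).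
  rewrite /adj; case: xgetP => // /(_ S); case; split; first split.
  - by move=> a u v; apply: Tinj; rewrite lT !ST.
  - by exists 1 => v; rewrite mul1r /hnorm -(unitary_norm uT) ST.
  - by move=> u v; rewrite -{1}(ST v) Td.
have TK : cancel T (adj T).
  move=> v; apply/eqP; rewrite -subr_eq0; apply/eqP/dot_eq0 => u.
  by rewrite dotBr -adjT Td subrr.
by split=> // w; rewrite -(ST w) TK.
Qed.

(** * Extension of isometries from a dense family of vectors *)

Section extension.
Context {H K : hilbertType R} {I : Type} {phi : I -> H} {psi : I -> K}.

(** Passage to the limit: an estimate whose error is proportional to the distance from [w] to the
    family holds without error. *)
Lemma dense_range_le (x y c : R[i]) (w : H) : dense (range phi) -> 0 <= c ->
  (forall i, x <= y + c * `|w - phi i|) -> x <= y.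
Proof.
move=> phid c0 xy; apply/ler_addgt0Pr => d d0.
have d1 : 0 < d / (c + 1) by rewrite divr_gt0 // ltr_wpDl.
have [||v []] := phid (ball w (d / (c + 1))).
- by exists w; exact: ballxx.
- exact: ball_open.
rewrite -ball_normE /= => wv [i _ iv]; apply: (le_trans (xy i)).
rewrite lerD2l iv; rewrite ltr_pdivlMr ?ltr_wpDl // in wv.
apply: le_trans (ltW wv); rewrite mulrC ler_wpM2l //.
by rewrite lerDl ler01.
Qed.

(** Both families share an index type, and [phi] need not be injective. That [phi i] determines
    [psi i] follows from [isometry_dist]. *)
Context (psi_dot : forall i j, dot (psi i) (psi j) = dot (phi i) (phi j)).
Context (phi_psi_linear : forall a i j, exists k,
  phi k = a *: phi i + phi j /\ psi k = a *: psi i + psi j).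
Context (phi_dense : dense (range phi)).

Lemma isometry_dist i j : `|psi i - psi j| = `|phi i - phi j|.
Proof.
apply/eqP; rewrite -(@eqrXn2 _ 2) //.
by rewrite -!dot_norm !(dotBl, dotBr) !psi_dot.
Qed.

(** [c] is the limit of [psi] along indices whose [phi] tends to [w]; that sequence is Cauchy
    because [psi] has the same distances as [phi]. The estimate against every [i] is all that the
    extension needs to know of [c]. *)
Lemma isometry_limit w : exists c, forall i, `|c - psi i| <= `|w - phi i|.
Proof.
have approx n : exists i, `|w - phi i| < (n.+1%:R^-1)%:C.
  have n0 : 0 < (n.+1%:R^-1 : R)%:C by rewrite ltcR invr_gt0.
  have [||v []] := phi_dense (O := ball w (n.+1%:R^-1)%:C).
  - by exists w; exact: ballxx.
  - exact: ball_open.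
  by rewrite -ball_normE /= => wv [i _ iv]; exists i; rewrite iv.
have [s sw] := choice approx.
have near_s (e : R[i]) : 0 < e -> \forall n \near \oo, `|w - phi (s n)| < e.
  move=> /posC_real[d d0 ->].
  have := near_infty_natSinv_lt (PosNum d0); apply: filterS => n /= nd.
  by apply: (lt_trans (sw n)); rewrite ltcR.
have cs : cvgn (psi \o s).
  apply/cauchy_cvgP/cauchy_exP => e e0.
  have e2 : 0 < e / 2 by rewrite divr_gt0.
  have [N _ sN] := near_s _ e2; exists (psi (s N)); exists N => // n nN /=.
  rewrite -ball_normE /= isometry_dist [ltRHS]splitr.
  apply: (le_lt_trans (ler_distD w _ _)); rewrite ltrD //; last exact: sN.
  by rewrite distrC; exact: (sN N (leqnn N)).
exists (lim (psi \o s @ \oo)) => i; apply/ler_addgt0Pr => e e0.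
have e2 : 0 < e / 2 by rewrite divr_gt0.
near \oo => n.
have A : `|lim (psi \o s @ \oo) - psi (s n)| < e / 2.
  by near: n; apply: (cvgrPdist_lt _ _).1 e2; exact: cs.
have B : `|w - phi (s n)| < e / 2 by near: n; exact: near_s.
apply: (le_trans (ler_distD (psi (s n)) _ _)); rewrite isometry_dist.
apply: (le_trans (lerD (ltW A) (ler_distD w (phi (s n)) (phi i)))).
by rewrite distrC addrA [leRHS]addrC lerD2r [leRHS]splitr lerD2l ltW.
Unshelve. all: by end_near. Qed.

Lemma isometry_extend : exists C : H -> K,
  [/\ linear C, forall u v, dot (C u) (C v) = dot u v
    & forall i, C (phi i) = psi i].
Proof.
have [C CP] := choice isometry_limit.
have eq0 (L : normedModType R[i]) (x : L) : `|x| <= 0 -> x = 0.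
  by rewrite normr_le0 => /eqP.
have Cphi i : C (phi i) = psi i.
  by apply/subr0_eq/eq0/(le_trans (CP _ _)); rewrite subrr normr0.
exists C; split=> // [a u v|u v].
- apply/subr0_eq/eq0.
  (* [u] and then [v] are approximated. Each error occurs twice, once from [C (a *: u + v)] and once
     from [a *: C u + C v], hence the factors 2. *)
  apply: (dense_range_le (w := u) (c := `|a| *+ 2) phi_dense) => [|i].
    by rewrite mulrn_wge0.
  apply: (dense_range_le (w := v) (c := 2) phi_dense) => // j.
  have [k [phik psik]] := phi_psi_linear a i j.
  have -> : C (a *: u + v) - (a *: C u + C v) = (C (a *: u + v) - psi k) -
      (a *: (C u - psi i) + (C v - psi j)).
    rewrite psik scalerBr; set x := C _; set y := a *: C u; set z := a *: psi i.
    by rewrite addrACA -opprD opprB addrA subrK.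
  have D : a *: u + v - phi k = a *: (u - phi i) + (v - phi j).
    by rewrite phik scalerBr opprD addrACA.
  apply: (le_trans (ler_normB _ _)); rewrite add0r.
  have E (L : normedModType R[i]) (p q : L) :
      `|a *: p + q| <= `|a| * `|p| + `|q|.
    by rewrite -normrZ ler_normD.
  have F : `|a *: (C u - psi i) + (C v - psi j)| <=
      `|a| * `|u - phi i| + `|v - phi j|.
    apply: (le_trans (E _ _ _)); rewrite lerD ?CP // ler_wpM2l //.
  have := le_trans (CP (a *: u + v) k) _; rewrite D => /(_ _ (E _ _ _)) G.
  apply: (le_trans (lerD G F)).
  by rewrite le_eqVlt; apply/orP; left; apply/eqP; ring.
(* Inner products are first compared with one argument in the dense family, then with both arguments
   arbitrary. *)
have dotC i w : dot (C w) (psi i) = dot w (phi i).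
  apply/subr0_eq/(eq0 R[i]^o).
  apply: (dense_range_le (w := w) (c := `|phi i| *+ 2) phi_dense) => [|j].
    by rewrite mulrn_wge0.
  have -> : dot (C w) (psi i) - dot w (phi i) =
      dot (C w - psi j) (psi i) - dot (w - phi j) (phi i).
    by rewrite !dotBl psi_dot; ring.
  have pn : `|psi i| = `|phi i|.
    by apply/eqP; rewrite -(@eqrXn2 _ 2) // -!dot_norm psi_dot.
  apply: (le_trans (ler_normB _ _)); rewrite add0r mulrnAl mulr2n mulrC.
  apply: lerD; apply: (le_trans (cauchy_schwarz _ _)) => //.
  by rewrite pn ler_wpM2r.
apply/subr0_eq/(eq0 R[i]^o).
apply: (dense_range_le (w := v) (c := `|C u| + `|u|) phi_dense) => [|i].
  by rewrite addr_ge0.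
have -> : dot (C u) (C v) - dot u v =
    dot (C u) (C v - psi i) - dot u (v - phi i).
  by rewrite !dotBr dotC; ring.
apply: (le_trans (ler_normB _ _)); rewrite add0r mulrDl.
apply: lerD; apply: (le_trans (cauchy_schwarz _ _)) => //.
by rewrite ler_wpM2l.
Qed.

Lemma bounded_op_unique (A B : H -> K) : bounded_op A -> bounded_op B ->
  (forall i, A (phi i) = B (phi i)) -> A = B.
Proof.
move=> [/linear_op[_ _ AB _] [a Aa]] [/linear_op[_ _ BB _] [b Bb]] AE.
apply/funext => w; apply/subr0_eq/eqP; rewrite -normr_le0.
(* Absolute values are taken since the constants in [bounded_op] carry no sign. *)
apply: (dense_range_le (w := w) (c := `|a|%:C + `|b|%:C) phi_dense) => [|i].
  by rewrite -rmorphD lecR addr_ge0.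
have -> : A w - B w = A (w - phi i) - B (w - phi i).
  by rewrite AB BB AE opprB addrA subrK.
have bound (D : H -> K) (d : R) v : hnorm (D v) <= d * hnorm v ->
    `|D v| <= `|d|%:C * `|v|.
  move=> Dd; rewrite !normE -rmorphM lecR (le_trans Dd) //.
  by rewrite ler_wpM2r ?hnorm_ge0 ?ler_norm.
by rewrite add0r mulrDl (le_trans (ler_normB _ _)) // lerD ?bound.
Qed.

End extension.

(** Extending in both directions gives isometries [C] and [D]. The composite [C \o D] is the
    identity on the dense range of [psi], hence everywhere, so [C] is surjective. *)
Lemma unitary_extend H K I (phi : I -> H) (psi : I -> K) :
  (forall i j, dot (psi i) (psi j) = dot (phi i) (phi j)) ->
  (forall a i j, exists k,
    phi k = a *: phi i + phi j /\ psi k = a *: psi i + psi j) ->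
  dense (range phi) -> dense (range psi) ->
  exists2 C : H -> K, unitary C & forall i, C (phi i) = psi i.
Proof.
move=> dE lE phid psid.
have [C [lC dC CE]] := isometry_extend dE lE phid.
have [D [lD dD DE]] : exists D : K -> H, [/\ linear D,
    forall u v, dot (D u) (D v) = dot u v & forall i, D (psi i) = phi i].
  by apply: isometry_extend => // a i j; have [k []] := lE a i j; exists k.
have isom_bounded (L M : hilbertType R) (A : L -> M) : linear A ->
    (forall u v, dot (A u) (A v) = dot u v) -> bounded_op A.
  move=> lA dA; split=> //; exists 1 => v; rewrite mul1r -lecR -!normE.
  by rewrite -(@ler_pXn2r _ 2) ?nnegrE // -!dot_norm dA.
have CD : C \o D = id.
  apply: (bounded_op_unique psid) => [||i /=]; last by rewrite DE CE.
    by apply: isom_bounded => [a u v|u v] /=; rewrite ?lD ?lC ?dC ?dD.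
  exact: isom_bounded.
exists C => //; split=> // w; exists (D w).
by rewrite -[RHS]/(id w) -CD.
Qed.

End unitaries.

Section tensor.
Context {R : realType}.

Lemma ten_linear (H K : hilbertType R) (T : tensor_product H K) :
  (forall v, linear (ten T ^~ v)) /\ forall u, linear (ten T u).
Proof.
by split=> [v a u u'|u a v v']; [exact: ten_linearl|exact: ten_linearr].
Qed.

(** Finite sums of simple tensors are indexed by lists of pairs; [ten_dot] shows that applying [V]
    and [U] to the pairs keeps inner products. The unitary extension meets the specification of
    [tensor_op], and density makes it the only bounded solution. *)
Lemma unitary_tensor_op (H K H' K' : hilbertType R) (T : tensor_product H K)
    (T' : tensor_product H' K') (V : H -> H') (U : K -> K') :
  unitary V -> unitary U -> unitary (tensor_op T T' V U).
Proof.
move=> uV uU; case: (uV) => lV dV _; case: (uU) => lU dU _.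
pose phi (s : seq (H * K)) : T := \sum_(p <- s) ten T p.1 p.2.
pose psi (s : seq (H * K)) : T' := \sum_(p <- s) ten T' (V p.1) (U p.2).
have [V0 VD VB VZ] := linear_op lV; have [U0 UD UB UZ] := linear_op lU.
have phid : dense (range phi).
  suff -> : range phi = [set w | exists s : seq (H * K),
      w = \sum_(p <- s) ten T p.1 p.2] by exact: ten_dense.
  by apply/seteqP; split=> [_ [s _ <-]|_ [s ->]]; exists s.
have [C uC CE] : exists2 C : T -> T', unitary C & forall s, C (phi s) = psi s.
  apply: unitary_extend => [s t|a s t|//|].
  - rewrite /phi /psi !dot_suml; apply: eq_bigr => p _.
    by rewrite !dot_sumr; apply: eq_bigr => q _; rewrite !ten_dot dV dU.
  - exists ([seq (a *: p.1, p.2) | p <- s] ++ t).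
    rewrite /phi /psi !big_cat !big_map /= !scaler_sumr.
    split; congr (_ + _); apply: eq_bigr => p _.
      by have [_ _ _ ->] := linear_op ((ten_linear T).1 p.2).
    by rewrite VZ; have [_ _ _ ->] := linear_op ((ten_linear T').1 (U p.2)).
  - suff -> : range psi = [set w | exists s : seq (H' * K'),
        w = \sum_(p <- s) ten T' p.1 p.2] by exact: ten_dense.
    apply/seteqP; split=> [_ [s _ <-]|_ [s ->]].
      by exists [seq (V p.1, U p.2) | p <- s]; rewrite big_map.
    (* Surjectivity of [V] and [U] makes the transformed sums exhaust all sums of simple tensors, so
       they are dense too. *)
    exists [seq (adj V p.1, adj U p.2) | p <- s] => //.
    rewrite /psi big_map; apply: eq_bigr => p _ /=.
    by rewrite (adj_unitary uV).2 (adj_unitary uU).2.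
suff -> : tensor_op T T' V U = C by [].
have Cten u v : C (ten T u v) = ten T' (V u) (U v).
  by have := CE [:: (u, v)]; rewrite /phi /psi !big_seq1.
rewrite /tensor_op; case: xgetP => [D _ [bD DE]|/(_ C)]; last first.
  by case; split=> //; exact: unitary_bounded.
apply: (bounded_op_unique phid bD (unitary_bounded uC)) => s.
rewrite CE /phi /psi; case: bD => /linear_op[D0 DD _ _] _.
by elim/big_rec2: _ => [//|p x y _ <-]; rewrite DD DE.
Qed.

End tensor.

(** * Groups as groupoids over one point *)

Section one_point_base.
Context {R : realType}.

Lemma unit_nbhs (x : unit) (A : set unit) : A tt -> nbhs x A.
Proof. by case: x => Att; exact/principal_filterP. Qed.

Lemma unit_open (A : set unit) : open A.
Proof. by rewrite openE => -[] Att; exact: unit_nbhs. Qed.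

Lemma unit_measurable (A : set (borel unit)) : measurable A.
Proof. by apply: sub_sigma_algebra; exact: unit_open. Qed.

Lemma cmeasurable_unit (f : unit -> R[i]) : cmeasurable f.
Proof. by split=> _ Y _; exact: unit_measurable. Qed.

(** The Dirac mass gives [tt] measure 1, so no null set contains it. *)
Lemma ae_point (P : unit -> Prop) :
  {ae @point_mass R, forall x, P x} <-> P tt.
Proof.
split=> [[N [_ N0 PN]]|Ptt]; last by apply: aeW => -[].
apply: contrapT => nP; have Ntt : N tt by exact: PN.
move: N0; rewrite /point_mass /= diracE mem_set // => -[/eqP].
by rewrite oner_eq0.
Qed.

Section classes.
Context {H : hfield R unit}.
Implicit Types (A : op_field H) (B : H tt -> H tt).

Lemma point_classP B A : point_class B A <-> B = A tt.
Proof. exact: ae_point. Qed.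

Lemma ae_class_point A : ae_class point_mass A = point_class (A tt).
Proof.
by congr ae_class; apply: functional_extensionality_dep => -[].
Qed.

(** The common argument behind all the bijections between operators and classes of fields in the
    theorem. *)
Lemma point_class_bij (P : set (H tt -> H tt)) (Q : set (op_field H)) :
  (forall A, Q A <-> P (A tt)) ->
  set_bij P [set ae_class point_mass A | A in Q] (@point_class R H).
Proof.
move=> QP; split.
- move=> B PB; exists (fun x => match x with tt => B end) => //.
  exact/QP.
- move=> B C _ _ BC.
  have /point_classP : point_class C (fun x => match x with tt => B end).
    by rewrite -BC; exact/point_classP.
  by [].
- move=> _ [A QA <-]; exists (A tt); first exact/QP.
  by rewrite ae_class_point.
Qed.

Lemma measurable_op_field_unit A : measurable_op_field A.
Proof. by move=> xi eta _ _; exact: cmeasurable_unit. Qed.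

Lemma is_Afield_point A : is_Afield point_mass A <-> bounded_op (A tt).
Proof.
split=> [[bA _ _]//|bA]; split.
- by case.
- exact: measurable_op_field_unit.
- by case: bA => _ [C bC]; exists C; exact/ae_point.
Qed.

(** The integral against the Dirac mass is the real part of the trace at [tt], and the imaginary
    part vanishes by positivity. *)
Lemma Dfield_point A :
  [/\ forall x, positive_op (A x) /\ trace_class (A x), measurable_op_field A
    & integral point_mass setT (fun x => (complex.Re (tr (A x)))%:E) = 1%E]
  <-> density (A tt).
Proof.
have intE : integral (@point_mass R) setT
    (fun x : borel unit => (complex.Re (tr (A x)))%:E) =
    (complex.Re (tr (A tt)))%:E.
  rewrite integral_dirac ?diracT ?mul1e //.
  by move=> _ Y _; exact: unit_measurable.
rewrite intE; split=> [[pt _ [re1]]|[pA tA ->]]; last first.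
  by split; [case|exact: measurable_op_field_unit|].
have [pA tA] := pt tt; split=> //.
by move: re1 (tr_density_real pA tA); case: (tr _) => a b /= -> ->.
Qed.

Lemma Sfield_point A :
  is_Afield point_mass A /\ {ae @point_mass R, forall x, density (A x)}
  <-> density (A tt).
Proof.
split=> [[_ /ae_point//]|dA]; split; last exact/ae_point.
by apply/is_Afield_point; case: dA => -[].
Qed.

Lemma Dfields_Sfields : Dfields point_mass H = Sfields point_mass H.
Proof.
rewrite /Dfields /Sfields; congr (image _ _); apply/seteqP; split=> A /=.
  by move/Dfield_point/Sfield_point.
by move/Sfield_point/Dfield_point.
Qed.

End classes.
End one_point_base.

(** Real and imaginary parts are 1-Lipschitz, so preimages of open rays are open, and these rays
    generate the Borel sets of the line. *)
Lemma ccontinuous_cmeasurable (R : realType) (X : ptopologicalType)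
  (f : X -> R[i]) : ccontinuous f -> cmeasurable f.
Proof.
move=> fc.
have part_measurable (p : R[i] -> R) :
    (forall a b, `|p a - p b|%:C <= `|a - b|) ->
    measurable_fun [set: borel X] (fun x : borel X => p (f x)).
  move=> pn.
  have pc : continuous (fun x : X => p (f x)).
    move=> x; apply/cvgrPdist_lt => e e0.
    have eC : 0 < e%:C :> R[i] by rewrite ltcR.
    have /cvgrPdist_lt/(_ _ eC) := fc x; apply: filterS => y fxy.
    by rewrite -ltcR (le_lt_trans (pn _ _)).
  apply: (measurability _ (RGenOInfty.measurableE R)) => _ [_ [x ->] <-].
  rewrite setTI; apply: sub_sigma_algebra.
  by apply: (open_comp (f := fun x : X => p (f x))) => [y _|//]; exact: pc.
split; apply: part_measurable => -[a1 a2] [b1 b2] /=.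
  by rewrite normc_def lecR -sqrtr_sqr ler_wsqrtr // lerDl sqr_ge0.
by rewrite normc_def lecR -sqrtr_sqr ler_wsqrtr // lerDr sqr_ge0.
Qed.

(** * Systems, reference frames and relativization for a group *)

Section systems.
Context {R : realType} {G : topGroupType}.
Context (Ghd : hausdorff_space G) (Glc : locally_compact [set: G]).
Context (Gsc : @second_countable G).
Local Notation Gam := (group_groupoid Ghd Glc Gsc).
Local Notation mu R :=
  (@point_mass R : {measure set (borel (base Gam)) -> \bar R}).

Lemma continuous_point_field (H : hilbertType R) :
  continuous_field (point_field H : hfield R (base Gam)).
Proof.
split=> //.
- by move=> xi _ x A /nbhs_singleton Ax; apply: unit_nbhs; case: x Ax.
- by move=> x O [v Ov] _; exists v; split=> //; exists (fun=> v).
Qed.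

(** A matrix coefficient is the trace of [U g] against a rank-one operator. *)
Lemma ccontinuous_matrix_coefficient (H : hilbertType R) (U : G -> H -> H) u v :
  group_system U -> ccontinuous (fun g => dot v (U g u)).
Proof.
move=> [Uu _ _ Uc]; have := Uc _ (trace_class_ketbra u v).
congr ccontinuous; apply/funext => g; apply: is_trace_tr.
have -> : U g \o ketbra u v = ketbra (U g u) v; last exact: is_trace_ketbra.
apply/funext => w; case: (Uu g) => /linear_op[_ _ _ UZ] _ _.
by rewrite /ketbra /= UZ.
Qed.

(* On a neighbourhood where chi stays trace-norm close to a fixed finite-rank
   operator, tr (U_g chi_g) is uniformly close to a finite sum of matrix
   coefficients of U. *)
Lemma group_fibrewise_uw_continuous (H : hilbertType R)
    (U : arrow_ops (Gam := Gam) (point_field H)) :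
  group_system U -> fibrewise_uw_continuous U.
Proof.
move=> gU chi [_ chiP] g0; have [W W0 WP] := chiP g0.
case: (gU) => Uu _ _ _; apply/cvgrPdist_le => d /posC_real[c c0 ->].
have c3 : 0 < c / 3 by rewrite divr_gt0.
have [n [xi [eta [_ _ WE]]]] := WP _ c3.
pose k g := \sum_j dot (eta j tt) (U g (xi j tt)).
have trE g : W g -> `|tr (U g \o chi g) - k g| <= (c / 3)%:C.
  move=> /WE /trace_norm_nuclear[x [y [r [nuc rc]]]].
  case: (Uu g) => lU _ _; have [U0 UD UB UZ] := linear_op lU.
  (* [z] is the trace of [U g] applied to the difference of [chi g] and the finite-rank operator;
     [U g] preserves norms, so the nuclear bound [r < c / 3] survives. *)
  have [z zP zr] :=
    nuclear_is_trace (nuclear_comp lU (unitary_norm (Uu g)) nuc).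
  have kP :
      is_trace (fun v => \sum_j ketbra (U g (xi j tt)) (eta j tt) v) (k g).
    by apply: is_trace_sum => j; exact: is_trace_ketbra.
  have -> : tr (U g \o chi g) = z + k g.
    apply: is_trace_tr; have := is_traceD zP kP; congr is_trace.
    apply/funext => v /=; rewrite UB.
    rewrite (big_morph (U g) UD U0) /=.
    under [X in _ - X]eq_bigr do rewrite /ketbra UZ.
    by rewrite subrK.
  by rewrite addrK (le_trans zr) // lecR ltW.
have kc : ccontinuous k.
  move=> g; apply: (@cvg_big R[i]^o _ +%R 0 xpredT (@add_continuous _)
    _ _ (index_enum 'I_n) (fun j g => dot (eta j tt) (U g (xi j tt)))) => j _.
  exact: (@ccontinuous_matrix_coefficient _ _ (xi j tt) (eta j tt) gU).
have Wg0 := nbhs_singleton W0.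
have c3C : 0 < (c / 3)%:C :> R[i] by rewrite ltcR.
have /cvgrPdist_le/(_ _ c3C) := kc g0.
move: W0; apply: filterS2 => g Wg kg.
apply: (le_trans (ler_distD (k g0) _ _)).
apply: (le_trans (lerD (trE _ Wg0) (ler_distD (k g) _ _))).
rewrite [in leRHS](_ : c = c / 3 + (c / 3 + c / 3)); last by lra.
rewrite !rmorphD lerD2l lerD // distrC; exact: trE.
Qed.

(** From groupoid to group, continuity is tested on constant fields. Conversely, measurability of
    the representation follows from continuity of its matrix coefficients. *)
Lemma groupoid_systemE (H : hilbertType R)
    (U : arrow_ops (Gam := Gam) (point_field H)) :
  groupoid_system U <-> group_system U.
Proof.
split=> [[_ [Uu UM U1 _] Uc]|gU].
  split=> //.
  - by apply/funext => v; exact: (U1 tt v).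
  - by move=> g h; apply/funext => v; exact: (UM g h erefl v).
  - move=> chi chi1; apply: (Uc (fun=> chi)); split=> // g.
    (* One truncation serves for every [g], because the field is constant. *)
    exists setT; first exact: filterT.
    move=> e e0; have [n [xi [eta chie]]] := trace_class_approx chi1 e0.
    by exists n, (fun j _ => xi j), (fun j _ => eta j).
split; [exact: continuous_point_field| |exact: group_fibrewise_uw_continuous].
case: (gU) => Uu U1 UM _; split=> //.
(* [e] proves [tt = tt]; replacing it by [erefl] makes the transports between fibres trivial. *)
- move=> g h e v; rewrite (Prop_irrelevance e erefl) /=.
  by rewrite /vcast /= UM.
- by case=> v; rewrite /vcast /= U1.
- move=> xi eta _ _; apply: ccontinuous_cmeasurable.
  exact: (@ccontinuous_matrix_coefficient _ _ (eta tt) (xi tt) gU).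
Qed.

Lemma tfib_point x : @tfib Gam x = setT.
Proof. by case: x; apply/seteqP; split. Qed.

Lemma Bor_on_tfib x : Bor_on (@tfib Gam x) = Bor G.
Proof.
rewrite tfib_point /Bor_on /Bor; congr smallest.
apply/seteqP; split=> [_ [W oW <-]|W oW]; first by rewrite setIT.
by exists W; rewrite ?setIT.
Qed.

(** Additivity on the constant sequence of empty sets gives a convergent series with constant terms,
    which must then be zero. *)
Lemma povm_set0 (X : ptopologicalType) (H : hilbertType R) (D : set X) B
  (E : set X -> H -> H) : B set0 -> is_povm D B E -> E set0 = fun=> 0.
Proof.
move=> B0 [_ _ Eadd]; apply/funext => v; apply: dot_eq0 => u.
have := Eadd (fun=> set0) (fun=> B0) _ u v; rewrite bigcup0 // => /(_ _)Es.
have /cvgP/cvg_series_cvg_0 s0 :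
    csum (fun=> dot u (E set0 v)) (dot u (E set0 v)).
  by apply: Es; apply/trivIsetP => i j _ _ _; rewrite setI0.
exact: (cvgc_unique (cvg_cst (dot u (E set0 v) : R[i]^o)) s0).
Qed.

Lemma groupoid_qrfE (H : hilbertType R)
    (U : arrow_ops (Gam := Gam) (point_field H))
    (E : groupoid_povms (Gam := Gam) (point_field H)) :
  (groupoid_qrf U E /\ admissible (mu R) E) <-> group_qrf U (E tt).
Proof.
split=> [[[gU Ep _ Ecov] _]|[gU Ep Ecov]].
  split; first exact/groupoid_systemE.
    by have := Ep tt; rewrite Bor_on_tfib tfib_point.
  by move=> g S BS; apply: Ecov; rewrite Bor_on_tfib.
split; first split.
- exact/groupoid_systemE.
- by case; rewrite Bor_on_tfib tfib_point.
- by move=> S _ xi eta _ _; exact: cmeasurable_unit.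
- by move=> g S; rewrite Bor_on_tfib; exact: Ecov.
apply/ae_point => N _; rewrite /point_mass /= diracE => N0.
(* A set that is null for the Dirac mass misses [tt], so no arrow has its source in it. *)
have -> : @src Gam @^-1` N `&` @tfib Gam tt = set0.
  rewrite tfib_point setIT; apply/seteqP; split=> // g /= Ntt.
  by move: N0; rewrite mem_set // => -[/eqP]; rewrite oner_eq0.
by apply: povm_set0 Ep; exact: sigma_algebra0.
Qed.

Section relativization.
Context {HS HR : hilbertType R} (T : tensor_product HS HR).
Local Notation FS := (point_field HS : hfield R (base Gam)).
Local Notation FR := (point_field HR : hfield R (base Gam)).
Local Notation FT :=
  (point_tensor T : forall x, tensor_product (FS x) (FR x)).
Implicit Types (V : arrow_ops (Gam := Gam) FS).
Implicit Types (E : groupoid_povms (Gam := Gam) FR).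

Lemma Afield_inv_point V (U : arrow_ops (Gam := Gam) FR)
    (B : op_field (boxtimes FT)) :
  group_system V -> group_system U ->
  (is_Afield (mu R) B /\ forall a,
    tensor_op (FT (src a)) (FT (trg a)) (V a) (U a) \o B (src a) \o
      adj (tensor_op (FT (src a)) (FT (trg a)) (V a) (U a)) = B (trg a))
  <-> group_invariant T V U (B tt).
Proof.
move=> [uV _ _ _] [uU _ _ _].
have WK g := adj_unitary (unitary_tensor_op T T (uV g) (uU g)).
split=> [[/is_Afield_point bB BE]|[bB BE]].
  split=> // g; have [W1 W2] := WK g; apply/funext => v /=.
  (* Evaluation at [W v], with [W] the tensor operator, cancels the adjoint; the converse below
     evaluates at the adjoint of [W] applied to [v]. *)
  by have /(congr1 (@^~ (tensor_op T T (V g) (U g) v))) := BE g; rewrite /= W1.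
split; first exact/is_Afield_point.
move=> g; have [W1 W2] := WK g; apply/funext => v /=.
have /(congr1 (@^~ (adj (tensor_op T T (V g) (U g)) v))) := BE g.
by rewrite /= W2.
Qed.

Lemma conj_op_point V (A : op_field FS) :
  conj_op V A (x := tt) = fun g => V g \o A tt \o adj (V g).
Proof.
apply/funext => g; rewrite /conj_op; case: pselect => // e.
by rewrite (Prop_irrelevance e erefl).
Qed.

(** The fibre over [tt] is all of [G] and the integrands coincide there, so both integrals are
    chosen by the same defining condition. *)
Lemma Rel_point V E (A : HS -> HS) :
  Rel (mu R) FT V E (@point_class R FS A) =
  @point_class R (boxtimes FT) (Yen T V (E tt) A).
Proof.
have relE A' : @rel_field R Gam FS FR FT V E A' tt = Yen T V (E tt) (A' tt).
  by rewrite /rel_field tfib_point conj_op_point.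
apply/seteqP; split=> [B [A' /point_classP -> /ae_point BE]|B /point_classP BE].
  by apply/point_classP; rewrite -relE.
exists (fun=> A); first exact/point_classP.
by apply/ae_point; rewrite relE.
Qed.

Lemma Rel_state_point V E (w : HR -> HR) (A : HS -> HS) :
  Rel_state (mu R) V E (@point_class R FR w) (@point_class R FS A) =
  @point_class R FS (Yen_state V (E tt) w A).
Proof.
have relE w' A' :
    @rel_state_field R Gam FS FR V E w' A' tt =
    Yen_state V (E tt) (w' tt) (A' tt).
  by rewrite /rel_state_field tfib_point conj_op_point.
apply/seteqP; split=> [B [w' [A' [/point_classP -> /point_classP ->]]]|B].
  by move=> /ae_point BE; apply/point_classP; rewrite -relE.
move=> /point_classP BE; exists (fun=> w), (fun=> A).
split; [exact/point_classP|exact/point_classP|].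
by apply/ae_point; rewrite relE.
Qed.

End relativization.
End systems.

Theorem theorem4p50 (R : realType) (G : topGroupType)
    (Ghd : hausdorff_space G) (Glc : locally_compact [set: G])
    (Gsc : @second_countable G)
    (HS HR : hilbertType R) (T : tensor_product HS HR) :
  let Gam := group_groupoid Ghd Glc Gsc in
  let mu : {measure set (borel (base Gam)) -> \bar R} := point_mass in
  let FS : hfield R (base Gam) := point_field HS in
  let FR : hfield R (base Gam) := point_field HR in
  let FT : forall x, tensor_product (FS x) (FR x) := point_tensor T in
  [/\ forall (U : arrow_ops (Gam := Gam) FR)
             (E : groupoid_povms (Gam := Gam) FR),
        (groupoid_qrf U E /\ admissible mu E) <-> group_qrf U (E tt),
      forall V : arrow_ops (Gam := Gam) FS,
        groupoid_system V <-> group_system V,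
      [/\ set_bij (@density R HR) (Dfields mu FR) (@point_class R FR),
          Dfields mu FR = Sfields mu FR,
          set_bij (@density R HS) (Dfields mu FS) (@point_class R FS)
        & Dfields mu FS = Sfields mu FS],
      [/\ set_bij (@bounded_op R HS HS) (Afields mu FS) (@point_class R FS),
          set_bij (@bounded_op R T T) (Afields mu (boxtimes FT))
            (@point_class R (boxtimes FT))
        & forall (V : arrow_ops (Gam := Gam) FS)
                 (U : arrow_ops (Gam := Gam) FR),
            groupoid_system V -> groupoid_system U ->
            set_bij (group_invariant T V U) (Afields_inv mu FT V U)
              (@point_class R (boxtimes FT))]
    & forall (V : arrow_ops (Gam := Gam) FS) (U : arrow_ops (Gam := Gam) FR)
             (E : groupoid_povms (Gam := Gam) FR),
        groupoid_system V -> groupoid_qrf U E -> admissible mu E ->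
        forall (A : HS -> HS) (w : HR -> HR), bounded_op A -> density w ->
          Rel mu FT V E (@point_class R FS A) =
            @point_class R (boxtimes FT) (Yen T V (E tt) A) /\
          Rel_state mu V E (@point_class R FR w) (@point_class R FS A) =
            @point_class R FS (Yen_state V (E tt) w A)].
Proof.
move=> Gam mu FS FR FT; split.
- by move=> U E; exact: groupoid_qrfE.
- by move=> V; exact: groupoid_systemE.
- split.
  + exact: (@point_class_bij R FR (@density R HR) _ (@Dfield_point R FR)).
  + exact: (@Dfields_Sfields R FR).
  + exact: (@point_class_bij R FS (@density R HS) _ (@Dfield_point R FS)).
  + exact: (@Dfields_Sfields R FS).
- split=> [||V U /groupoid_systemE gV /groupoid_systemE gU].
  + exact: (@point_class_bij R FS (@bounded_op R HS HS) _
      (@is_Afield_point R FS)).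
  + exact: (@point_class_bij R (boxtimes FT) (@bounded_op R T T) _
      (@is_Afield_point R (boxtimes FT))).
  + apply: (@point_class_bij R (boxtimes FT) (group_invariant T V U)) => B.
    exact: Afield_inv_point.
- move=> V U E _ _ _ A w _ _.
  by split; [exact: Rel_point|exact: Rel_state_point].
Qed.
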